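(* For every integer $n\ge 2$ and every $\delta\ge 0$ there is a constant $C_{po}=C_{po}(n,\delta)$ such that the following holds. Let $G\subsetneq\mathbb{R}^n$ be a $\delta$-hyperbolic domain. Then for any $x,y\in G$, any quasihyperbolic geodesic $[x,y]_k$ in $G$ with end points $x$ and $y$, and each curve $\gamma$ in $G$ with end points $x$ and $y$, $$\operatorname{diam}([x,y]_k)\le C_{po}\operatorname{diam}(\gamma).$$ If in addition $G$ is a domain of $C_{bt}$-bounded turning, then $$\operatorname{diam}([x,y]_k)\le C_{bt}C_{po}|x-y|.$$ Here $\operatorname{diam}$ is the Euclidean diameter.
   Context: A domain is an open connected set. For a domain $G\subsetneq\mathbb{R}^n$ ($n\ge2$), $d(z)=\operatorname{dist}(z,\partial G)$ (Euclidean), and the quasihyperbolic metric is $k(x,y)=k_G(x,y)=\inf_\gamma\int_\gamma \frac{ds}{d(z)}$, the infimum over all rectifiable curves $\gamma$ in $G$ with end points $x,y$, where $ds$ is Euclidean arc length. The space $(G,k)$ is complete, proper and geodesic. A quasihyperbolic geodesic $[x,y]_k$ is a geodesic of $(G,k)$ joining $x$ and $y$, that is, (the image of) a map $\sigma:[0,l]\to G$ with $\sigma(0)=x$, $\sigma(l)=y$ and $k(\sigma(t),\sigma(t'))=|t-t'|$. $G$ is called a ($\delta$-)hyperbolic domain, or Gromov $\delta$-hyperbolic, if $(x|y)_o\ge\min\{(x|z)_o,(z|y)_o\}-\delta$ for all $x,y,z,o\in G$, where $(x|y)_o=\frac12(k(x,o)+k(y,o)-k(x,y))$. A metric space $(X,d)$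 is $C_{bt}$-bounded turning ($C_{bt}\ge1$) if each pair of points $x,y\in X$ can be joined by a curve $\gamma$ in $X$ with $\operatorname{diam}(\gamma)\le C_{bt}\,d(x,y)$; for a domain $G$ this refers to the Euclidean metric. A curve is (the image of) a continuous map from an interval. *)

(* Defs.v *)
From mathcomp Require Import all_boot all_order all_algebra.
From mathcomp Require Import all_classical all_reals all_analysis.
Import Order.TTheory GRing.Theory Num.Theory.
Import numFieldNormedType.Exports.

Set Implicit Arguments.
Unset Strict Implicit.
Unset Printing Implicit Defensive.

Local Open Scope classical_set_scope.
Local Open Scope ring_scope.

(* The norm that the library puts on 'rV[R]_n is the sup norm.  It induces the
   Euclidean topology, so open sets, closures, connectedness and continuity are
   the library's, but every length, distance and diameter below uses [enorm]. *)
Definition enorm (R : realType) (n : nat) (v : 'rV[R]_n) : R :=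
  Num.sqrt (\sum_(i < n) v ord0 i ^+ 2).

Definition ediam (R : realType) (n : nat) (A : set 'rV[R]_n) : \bar R :=
  ereal_sup [set (enorm (u - v))%:E | u in A & v in A].

Definition is_domain (R : realType) (n : nat) (G : set 'rV[R]_n) : Prop :=
  open G /\ connected G.

Definition boundary (T : topologicalType) (A : set T) : set T :=
  closure A `\` interior A.

Definition bdist (R : realType) (n : nat) (G : set 'rV[R]_n) (z : 'rV[R]_n)
    : R :=
  inf [set enorm (z - w) | w in boundary G].

Definition curve_in (R : realType) (n : nat) (A : set 'rV[R]_n)
    (x y : 'rV[R]_n) (a b : R) (g : R -> 'rV[R]_n) : Prop :=
  [/\ a <= b, {within `[a, b], continuous g}, g @` `[a, b] `<=` A,
      g a = x & g b = y].

(* The partitions of the library omit their left end point: [s] stands for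
   a = t_0 < t_1 < ... < t_k = b with s = [:: t_1; ...; t_k]. *)
Definition curve_length (R : realType) (n : nat) (a b : R)
    (g : R -> 'rV[R]_n) : \bar R :=
  ereal_sup [set (\sum_(0 <= i < size s)
                    enorm (g (nth b (a :: s) i.+1) - g (nth b (a :: s) i)))%:E
            | s in itv_partition a b].

Definition rectifiable (R : realType) (n : nat) (a b : R)
    (g : R -> 'rV[R]_n) : Prop :=
  (curve_length a b g < +oo)%E.

(* Arc length parametrization: the point reached after length [s], i.e. g t for
   the first t such that the restriction of g to [a, t] has length at least
   [s] (hence exactly [s], when g is continuous and rectifiable). *)
Definition arclength_param (R : realType) (n : nat) (a b : R)
    (g : R -> 'rV[R]_n) (s : R) : 'rV[R]_n :=
  g (inf [set t | t \in `[a, b] /\ (s%:E <= curve_length a t g)%E]).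

Definition curve_integral (R : realType) (n : nat) (rho : 'rV[R]_n -> R)
    (a b : R) (g : R -> 'rV[R]_n) : \bar R :=
  (\int[@lebesgue_measure R]_(s in `[0%R, fine (curve_length a b g)])
     (rho (arclength_param a b g s))%:E)%E.

(* The infimum is finite whenever G is a domain, G <> R^n and x, y lie in G. *)
Definition qh_dist (R : realType) (n : nat) (G : set 'rV[R]_n)
    (x y : 'rV[R]_n) : R :=
  fine (ereal_inf [set L : \bar R | exists a b g,
    [/\ curve_in G x y a b g, rectifiable a b g
      & L = curve_integral (fun z => (bdist G z)^-1) a b g]]).

(* The geodesic [x, y]_k itself is the image of [0, l] under [sigma]. *)
Definition qh_geodesic (R : realType) (n : nat) (G : set 'rV[R]_n)
    (x y : 'rV[R]_n) (l : R) (sigma : R -> 'rV[R]_n) : Prop :=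
  [/\ 0 <= l, sigma @` `[0, l] `<=` G, sigma 0 = x, sigma l = y
    & forall t t', t \in `[0, l] -> t' \in `[0, l] ->
        qh_dist G (sigma t) (sigma t') = `|t - t'|].

Definition gromov_product (R : realType) (T : Type) (k : T -> T -> R)
    (o x y : T) : R :=
  2^-1 * (k x o + k y o - k x y).

Definition gromov_hyperbolic (R : realType) (n : nat) (G : set 'rV[R]_n)
    (delta : R) : Prop :=
  forall x y z o, G x -> G y -> G z -> G o ->
    gromov_product (qh_dist G) o x y >=
    Num.min (gromov_product (qh_dist G) o x z)
            (gromov_product (qh_dist G) o z y) - delta.

Definition bounded_turning (R : realType) (n : nat) (A : set 'rV[R]_n)
    (C : R) : Prop :=
  forall x y, A x -> A y -> exists a b g,
    curve_in A x y a b g /\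
    (ediam (g @` `[a, b]) <= (C * enorm (x - y))%:E)%E.

(* Main.v *)
(* Let sigma be a quasihyperbolic geodesic from x to y, let z be a point of it,
   and let gamma be a curve from x to y of diameter D.  If d(x) > 4 D, then
   k(x, y) is small and z is close to x.  Otherwise suppose that z is far from x
   compared with D.  As (x|y)_z = 0, the curve gamma has visual diameter about 1
   seen from z, so one can choose N points on gamma which are evenly spread for
   the visual metric.  Almost geodesics from z to these N points all cross the
   dyadic annuli around x that separate z from gamma.  Cut each annulus into
   Whitney cells.  A cell p is met by at most C N exp(- eps k(z, p)) of the
   almost geodesics, because two that meet the same cell end at points whose
   visual distance is at most C exp(- eps k(z, p)).  Crossing an annulus costs
   a fixed total of relative cell diameters.  Cells met by few of the curves
   contribute at most half of it, by a volume count; in the other cells the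
   diameter is bounded by C exp(- eps k(z, p) / n), which sums along an almost
   geodesic to a constant that does not depend on the number of annuli.  Hence
   the number of annuli is bounded in terms of n and delta. *)
From HB Require Import structures.
Require Import Defs.
From mathcomp Require Import all_boot all_order all_algebra.
From mathcomp Require Import all_classical all_reals all_analysis.
From mathcomp Require Import ring lra measurable_realfun zify.
Import Order.TTheory GRing.Theory Num.Theory.
Import numFieldNormedType.Exports.
Set Implicit Arguments.
Unset Strict Implicit.
Unset Printing Implicit Defensive.
Local Open Scope classical_set_scope.
Local Open Scope ring_scope.

(** Only almost geodesics enter: [k] is an infimum, so a path from z with excess at most 1 is cut
    into a finite chain whose steps are shorter than d/8 or equal to it and cost at least 1/9. All
    additive errors, also the 2 delta of an approximate triangle inequality drawn from hyperbolicity
    itself, end up in the constants. The visual distance is only a quasi-metric. Frink's chain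
    construction replaces it by a distance from x, called height below; sample number l sits near
    height l/(2N), so visually close samples have close indices, which turns the shadow estimate
    into a count of integers. N is fixed after gamma has been discretized, large enough that 1/N
    lies below the visual resolution at the samples, and it cancels at the end. The volume count
    compares visits to a cell with the n-th power of its relative diameter; the n-th root of the
    exponential bound still decays geometrically along a chain, and that makes the sum independent
    of the number of annuli. *)

Section euclidean_norm.
Context {R : realType} {n : nat}.
Implicit Types u v w : 'rV[R]_n.

(** * Euclidean norm: Cauchy-Schwarz and comparison with the sup norm *)

Lemma enorm_ge0 u : 0 <= enorm u.
Proof. exact: sqrtr_ge0. Qed.

Lemma enorm_sqr u : enorm u ^+ 2 = \sum_(i < n) u ord0 i ^+ 2.
Proof. by rewrite sqr_sqrtr// sumr_ge0// => i _; exact: sqr_ge0. Qed.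

Lemma enormN u : enorm (- u) = enorm u.
Proof. by congr Num.sqrt; apply: eq_bigr => i _; rewrite mxE sqrrN. Qed.

Lemma enormZ (k : R) u : enorm (k *: u) = `|k| * enorm u.
Proof.
rewrite /enorm -sqrtr_sqr -sqrtrM ?sqr_ge0//; congr Num.sqrt.
by rewrite mulr_sumr; apply: eq_bigr => i _; rewrite mxE exprMn.
Qed.

Lemma enorm0 : enorm (0 : 'rV[R]_n) = 0.
Proof. by rewrite -(scale0r 0) enormZ normr0 mul0r. Qed.

Lemma enorm_coord u i : `|u ord0 i| <= enorm u.
Proof.
rewrite -sqrtr_sqr ler_wsqrtr// (bigD1 i)//= lerDl sumr_ge0// => j _.
exact: sqr_ge0.
Qed.

Lemma enorm_dot_le u v : \sum_(i < n) u ord0 i * v ord0 i <= enorm u * enorm v.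
Proof.
have [u0|u0] := eqVneq (enorm u) 0.
  rewrite u0 mul0r big1// => i _; have := enorm_coord u i.
  by rewrite u0 normr_le0 => /eqP ->; rewrite mul0r.
have [v0|v0] := eqVneq (enorm v) 0.
  rewrite v0 mulr0 big1// => i _; have := enorm_coord v i.
  by rewrite v0 normr_le0 => /eqP ->; rewrite mulr0.
have uv0 : 0 < enorm u * enorm v by rewrite mulr_gt0// lt_def ?u0 ?v0 enorm_ge0.
have : 0 <= \sum_(i < n) (enorm v * u ord0 i - enorm u * v ord0 i) ^+ 2.
  by rewrite sumr_ge0// => i _; exact: sqr_ge0.
have -> : \sum_(i < n) (enorm v * u ord0 i - enorm u * v ord0 i) ^+ 2 =
    enorm v ^+ 2 * (\sum_(i < n) u ord0 i ^+ 2)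
    - 2 * (enorm u * enorm v) * (\sum_(i < n) u ord0 i * v ord0 i)
    + enorm u ^+ 2 * (\sum_(i < n) v ord0 i ^+ 2).
  rewrite !mulr_sumr -sumrB -big_split/=; apply: eq_bigr => i _; ring.
rewrite -!enorm_sqr => H.
have {H} : 0 <= 2 * (enorm u * enorm v) *
    (enorm u * enorm v - \sum_(i < n) u ord0 i * v ord0 i).
  by move: H; congr (0 <= _); ring.
have uv2 : 0 < 2 * (enorm u * enorm v) by rewrite mulr_gt0.
by rewrite pmulr_rge0// subr_ge0.
Qed.

Lemma ler_enormD u v : enorm (u + v) <= enorm u + enorm v.
Proof.
rewrite -(@ler_pXn2r _ 2)// ?nnegrE ?addr_ge0 ?enorm_ge0// sqrrD !enorm_sqr.
have -> : \sum_(i < n) (u + v) ord0 i ^+ 2 = \sum_(i < n) u ord0 i ^+ 2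
    + 2 * (\sum_(i < n) u ord0 i * v ord0 i) + \sum_(i < n) v ord0 i ^+ 2.
  by rewrite mulr_sumr -!big_split/=; apply: eq_bigr => i _; rewrite !mxE; ring.
rewrite lerD2r lerD2l -[leRHS]mulr_natl ler_wpM2l//; exact: enorm_dot_le.
Qed.

Lemma enorm_distC u v : enorm (u - v) = enorm (v - u).
Proof. by rewrite -enormN opprB. Qed.

Lemma ler_enorm_dist w u v : enorm (u - v) <= enorm (u - w) + enorm (w - v).
Proof. by rewrite -(subrKA w); exact: ler_enormD. Qed.

Lemma enorm_eq0 u : enorm u = 0 -> u = 0.
Proof.
move=> u0; apply/rowP => i; rewrite mxE; apply/normr0_eq0/eqP.
by rewrite -normr_le0 normr_id -u0 enorm_coord.
Qed.

Lemma enorm_dist_eq0 u v : enorm (u - v) = 0 -> u = v.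
Proof. by move=> /enorm_eq0/eqP; rewrite subr_eq0 => /eqP. Qed.

Lemma enorm_le_sum u : enorm u <= \sum_(i < n) `|u ord0 i|.
Proof.
have H0 : 0 <= \sum_(i < n) `|u ord0 i| by apply: sumr_ge0.
rewrite -(@ler_pXn2r _ 2)// ?nnegrE ?enorm_ge0// enorm_sqr expr2 mulr_suml.
apply: ler_sum => i _; rewrite -real_normK ?num_real// expr2 ler_wpM2l//.
by rewrite (bigD1 i)//= lerDl sumr_ge0.
Qed.

Lemma mx_norm_le_enorm u : `|u| <= enorm u.
Proof.
have -> : `|u| = mx_norm u by [].
rewrite mx_normrE; apply/bigmax_leP; split; first exact: enorm_ge0.
by move=> [i j] _ /=; rewrite ord1 enorm_coord.
Qed.

Lemma enorm_le_mx_norm u : enorm u <= n%:R * `|u|.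
Proof.
apply: (le_trans (enorm_le_sum u)).
apply: (@le_trans _ _ (\sum_(i < n) `|u|)); last first.
  by rewrite sumr_const card_ord mulr_natl.
apply: ler_sum => i _; have -> : `|u| = mx_norm u by [].
by rewrite mx_normrE; apply: (@le_bigmax_cond _ _ _ _ (ord0, i)).
Qed.

(** Bridge from the sup norm topology to Euclidean balls: the two norms differ by a factor of at
    most [n]. *)
Lemma nbhs_enormP u (A : set 'rV[R]_n) :
  nbhs u A <-> exists2 e : R, 0 < e & forall v, enorm (u - v) < e -> A v.
Proof.
split=> [/nbhs_ballP[e/= e0 eA]|[e e0 eA]].
  exists e => // v uv; apply: eA; rewrite -ball_normE/=.
  exact: le_lt_trans (mx_norm_le_enorm _) uv.
(* [n.+1] instead of [n] keeps the divisor positive when [n = 0]. *)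
apply/nbhs_ballP; exists (e / n.+1%:R) => /=; first by rewrite divr_gt0.
move=> v; rewrite -ball_normE/= ltr_pdivlMr// => uv; apply: eA.
apply: le_lt_trans uv; apply: (le_trans (enorm_le_mx_norm _)).
by rewrite mulrC ler_wpM2l// ler_nat.
Qed.

Lemma within_continuous_enormP (a b : R) (g : R -> 'rV[R]_n) :
  {within `[a, b], continuous g} <->
  forall t, t \in `[a, b] -> forall e, 0 < e -> exists2 h : R, 0 < h &
    forall s, s \in `[a, b] -> `|t - s| < h -> enorm (g t - g s) < e.
Proof.
split=> [/subspace_continuousP H t tab e e0|H].
  have /H : [set` `[a, b]] t by [].
  move/(_ [set v | enorm (g t - v) < e]); rewrite /= nbhs_simpl/=.
  have /[swap]/[apply] : nbhs (g t) [set v | enorm (g t - v) < e].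
    by apply/nbhs_enormP; exists e.
  rewrite /fmap/= /within/= => /nbhs_ballP[h h0 hP].
  by exists h => // s sab ts; apply: hP => //; rewrite -ball_normE.
apply/subspace_continuousP => t tab A /nbhs_enormP[e e0 eA].
have [h h0 hP] := H t tab e e0.
apply/nbhs_ballP; exists h => //= s; rewrite -ball_normE/= => ts sab.
by apply: eA; exact: hP.
Qed.

End euclidean_norm.

(** * Domains and the distance to the boundary *)

Section domain.
Context {R : realType} {n : nat} (G : set 'rV[R]_n).
Hypothesis Gdom : is_domain G.
Implicit Types x y z u v w : 'rV[R]_n.

Lemma is_domain_ball z : G z ->
  exists2 e : R, 0 < e & forall v, enorm (z - v) < e -> G v.
Proof. by move=> Gz; apply/nbhs_enormP; apply: open_nbhs_nbhs; split => //; case: Gdom. Qed.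

(** Induction over a connected set: local invariance makes the trace of [P] on [G] relatively open
    and closed. It serves to reach every point of [G] by a rectifiable path. *)
Lemma is_domain_ind (P : set 'rV[R]_n) z0 : G z0 -> P z0 ->
  (forall z, G z -> exists2 e : R, 0 < e &
     forall v, enorm (z - v) < e -> (P z <-> P v)) ->
  G `<=` P.
Proof.
move=> Gz0 Pz0 loc; have [oG cG] := Gdom.
suff : G `&` P = G by move=> <- z [].
apply: cG; first by exists z0.
(* A union of balls on each of which [P] holds throughout: open, with trace [P] on [G]. *)
- exists [set z | exists2 v, G v /\ P v & exists2 e, 0 < e &
     (forall u, enorm (v - u) < e -> P v <-> P u) /\ enorm (v - z) < e]; last first.
    apply/seteqP; split=> [z [Gz Pz]|z [Gz [v [Gv Pv] [e e0 [ev vz]]]]].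
      split => //; exists z => //; have [e e0 eP] := loc z Gz.
      by exists e => //; rewrite subrr enorm0.
    by split => //; apply/(ev z).
  rewrite openE => z [v [Gv Pv] [e e0 [ev vz]]].
  apply/nbhs_enormP; exists (e - enorm (v - z)); first by rewrite subr_gt0.
  move=> u zu; exists v => //; exists e => //; split => //.
  by apply: le_lt_trans (ler_enorm_dist z _ _) _; rewrite -ltrBrDl.
- exists (closure (G `&` P)); first exact: closed_closure.
  apply/seteqP; split=> [z [Gz Pz]|z [Gz clz]].
    by split => //; apply: subset_closure; split.
  split => //; have [e e0 eP] := loc z Gz.
  have [|v [[Gv Pv] zv]] := clz [set v | enorm (z - v) < e].
    by apply/nbhs_enormP; exists e.
  exact/(eP v zv).
Qed.

Lemma boundaryP w : boundary G w -> ~ G w.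
Proof.
move=> [_ nGw] Gw; apply: nGw; apply: open_nbhs_nbhs; split => //.
by case: Gdom.
Qed.

(* The boundary point is the first exit point of the segment [z, u]. *)
Lemma boundary_segment z u : G z -> ~ G u ->
  exists2 w, boundary G w & enorm (z - w) <= enorm (z - u).
Proof.
move=> Gz nGu; pose p t := z + t *: (u - z).
pose S := [set t : R | 0 <= t <= 1 /\ forall s, 0 <= s <= t -> G (p s)].
have p0 : p 0 = z by rewrite /p scale0r addr0.
have p1 : p 1 = u by rewrite /p scale1r addrC subrK.
have pE s t : enorm (p s - p t) = `|s - t| * enorm (u - z).
  by rewrite -enormZ /p opprD addrACA subrr add0r -scalerBl.
have S0 : S 0.
  by split=> [|s /le_anti <-]; rewrite ?lexx ?ler01// p0.
have supS : has_sup S.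
  by split; [exists 0|exists 1 => t [/andP[]]].
set T := sup S.
have T0 : 0 <= T by apply: ub_le_sup => //; case: supS.
have T1 : T <= 1 by apply: ge_sup; [exists 0|move=> t [/andP[]]].
have below s : 0 <= s < T -> G (p s).
  move=> /andP[s0 sT]; have Ts : 0 < T - s by rewrite subr_gt0.
  have [t [_ tP] st] := sup_adherent Ts supS.
  by apply: tP; rewrite s0/=; apply: ltW; move: st; rewrite subKr.
have pT : ~ G (p T).
  move=> GpT; have T1' : T < 1.
    by rewrite lt_def T1 andbT; apply/eqP => T1'; rewrite -T1' p1 in GpT.
  have [e e0 eP] := is_domain_ball GpT.
  have uz0 : 0 < enorm (u - z) + 1 by rewrite ltr_wpDl// enorm_ge0.
  pose h := Num.min (1 - T) (e / (enorm (u - z) + 1) / 2).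
  have h0 : 0 < h by rewrite lt_min subr_gt0 T1'/= !divr_gt0.
  have hT : h <= 1 - T by rewrite ge_min lexx.
  have he : h * (enorm (u - z) + 1) <= e / 2.
    rewrite -ler_pdivlMr//; apply: (@le_trans _ _ (e / (enorm (u - z) + 1) / 2)).
      by rewrite ge_min lexx orbT.
    by rewrite mulrAC.
  suff : S (T + h).
    by move=> /(ub_le_sup (proj2 supS)); rewrite -/T gerDl leNgt h0.
  split=> [|s /andP[s0 sT]]; first by rewrite addr_ge0 ?(ltW h0)//= -lerBrDl.
  have [sT'|Ts] := ltP s T; first by apply: below; rewrite s0.
  apply: eP; rewrite pE distrC ger0_norm ?subr_ge0//.
  have sTh : s - T <= h by rewrite lerBlDl.
  have := ler_wpM2r (enorm_ge0 (u - z)) sTh; nra.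
have T0' : 0 < T.
  by rewrite lt_def T0 andbT; apply/eqP => T0'; rewrite T0' p0 in pT.
exists (p T); last first.
  rewrite -[in enorm (z - p T)]p0 pE sub0r normrN ger0_norm// (enorm_distC z).
  by rewrite ler_piMl// enorm_ge0.
split=> [A /nbhs_enormP[e e0 eA]|/interior_subset//].
have uz0 : 0 < enorm (u - z) + 1 by rewrite ltr_wpDl// enorm_ge0.
pose h := Num.min T (e / (enorm (u - z) + 1) / 2).
have h0 : 0 < h by rewrite lt_min T0'/= !divr_gt0.
have hT : h <= T by rewrite ge_min lexx.
have he : h * (enorm (u - z) + 1) <= e / 2.
  rewrite -ler_pdivlMr//; apply: (@le_trans _ _ (e / (enorm (u - z) + 1) / 2)).
    by rewrite ge_min lexx orbT.
  by rewrite mulrAC.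
exists (p (T - h)); split.
  by apply: below; rewrite subr_ge0 hT ltrBlDr ltrDl.
apply: eA; rewrite pE subKr gtr0_norm//; nra.
Qed.

Hypothesis GT : G <> setT.

Lemma boundary_neq0 z : G z -> boundary G !=set0.
Proof.
move=> Gz; have [u nGu] : exists u, ~ G u.
  apply: contrapT => /forallNP H; apply: GT; apply/seteqP; split => // u _.
  exact: contrapT.
by have [w wG _] := boundary_segment Gz nGu; exists w.
Qed.

Lemma bdist_has_inf z u : G z -> has_inf [set enorm (u - w) | w in boundary G].
Proof.
move=> /boundary_neq0[w wG]; split; first by exists (enorm (u - w)), w.
by exists 0 => _ [v _ <-]; exact: enorm_ge0.
Qed.

Lemma bdist_le z w : G z -> boundary G w -> bdist G z <= enorm (z - w).
Proof.
by move=> Gz wG; apply: ge_inf; [case: (bdist_has_inf z Gz)|exists w].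
Qed.

(** [u] is arbitrary, so later estimates can bound [bdist G u] before knowing that [u] lies in
    [G]. *)
Lemma bdist_lip z u : G z -> bdist G u <= bdist G z + enorm (z - u).
Proof.
move=> Gz; rewrite -lerBlDr; apply: lb_le_inf; first by case: (bdist_has_inf z Gz).
move=> _ [w wG <-]; rewrite lerBlDr addrC (enorm_distC z).
apply: le_trans (ler_enorm_dist z _ _).
by apply: ge_inf; [case: (bdist_has_inf u Gz)|exists w].
Qed.

Lemma bdist_gt0 z : G z -> 0 < bdist G z.
Proof.
move=> Gz; have [e e0 eP] := is_domain_ball Gz.
apply: lt_le_trans e0 _; apply: lb_le_inf; first by case: (bdist_has_inf z Gz).
move=> _ [w /boundaryP nGw <-]; rewrite leNgt; apply/negP => /eP; exact: nGw.
Qed.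

Lemma bdist_ball z u : G z -> enorm (z - u) < bdist G z -> G u.
Proof.
move=> Gz zu; apply: contrapT => /(boundary_segment Gz)[w wG].
by apply/negP; rewrite -ltNge; apply: lt_le_trans zu _; exact: bdist_le.
Qed.

End domain.

(** Local-to-global principle in place of compactness of [[a, b]]: at the supremum of the [t] with
    [Q a t], a local interval can still be appended, so the supremum is attained and equals [b]. *)
Lemma cousin {R : realType} (Q : R -> R -> Prop) (a b : R) : a <= b ->
  (forall r s t, a <= r -> r <= s -> s <= t -> t <= b -> Q r s -> Q s t -> Q r t) ->
  (forall t, a <= t <= b -> exists2 h : R, 0 < h &
     forall r s, a <= r -> r <= s -> s <= b -> `|t - r| < h -> `|t - s| < h ->
       Q r s) ->
  Q a b.
Proof.
move=> ab trQ locQ; pose S := [set t : R | a <= t <= b /\ Q a t].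
have Sa : S a.
  split; first by rewrite lexx.
  have [|h h0 hQ] := locQ a; first by rewrite lexx.
  by apply: hQ; rewrite // subrr normr0.
have supS : has_sup S by split; [exists a|exists b => t [/andP[]]].
have aT : a <= sup S by apply: ub_le_sup => //; case: supS.
have Tb : sup S <= b by apply: ge_sup; [exists a|move=> t [/andP[]]].
have [|h h0 hQ] := locQ (sup S); first by rewrite aT.
have [t [/andP[at_ tb] Qat] tS] := sup_adherent h0 supS.
have tS' : t <= sup S by apply: ub_le_sup; [case: supS|rewrite /S/= at_ tb].
(* Unless clipped at [b], this point of [S] would exceed the supremum. *)
pose s := Num.min b (sup S + h / 2).
have sb : s <= b by rewrite ge_min lexx.
have Ss : sup S <= s by rewrite le_min Tb lerDl divr_ge0// ltW.
have Qas : Q a s.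
  apply: (trQ a t s) => //; first exact: le_trans Ss.
  apply: hQ => //; first exact: le_trans Ss.
    by rewrite ger0_norm ?subr_ge0//; lra.
  rewrite distrC ger0_norm ?subr_ge0//.
  have : s <= sup S + h / 2 by rewrite ge_min lexx orbT.
  lra.
suff <- : s = b by [].
have : s <= sup S.
  apply: ub_le_sup; first by case: supS.
  by split => //; rewrite sb (le_trans aT).
by rewrite /s; have [//|_] := ltP b (sup S + h / 2); lra.
Qed.

(** * Translation and splitting of Lebesgue integrals *)

Section translation.
Context {R : realType}.
Local Open Scope ereal_scope.
Local Notation mu := (@lebesgue_measure R).

Lemma lebesgue_measure_translate (c : R) (A : set R) : measurable A ->
  pushforward mu (fun x : measurableTypeR R => (x - c)%R : measurableTypeR R) A
  = mu A.
Proof.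
pose phi : measurableTypeR R -> measurableTypeR R := fun x => (x - c)%R.
have mphi : measurable_fun setT phi.
  by apply: nondecreasing_measurable => // x y xy; rewrite lerB.
pose mphi_mixin := isMeasurableFun.Build _ _ _ _ _ mphi.
pose phi' : {mfun _ >-> _} := HB.pack phi mphi_mixin.
move=> mA; apply/esym; apply: (@lebesgue_measure_unique _ (pushforward mu phi')) => //.
move=> _ [[u v] _ <-]; rewrite /pushforward/=.
rewrite [RHS](_ : _ = mu `](u + c)%R, (v + c)%R]%classic); last first.
  congr (mu _).
  by apply/seteqP; split=> x /=; rewrite !in_itv/= ltrBrDr lerBlDr.
rewrite !lebesgue_measure_itv/= !lte_fin ltrD2r; case: ifP => // _.
by rewrite -!EFinB; congr EFin; ring.
Qed.

Lemma integral_translate (c l : R) (f : R -> \bar R) :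
  measurable_fun `]0%R, l] f -> (forall x, x \in `]0%R, l] -> 0 <= f x) ->
  \int[mu]_(x in `]c, (c + l)%R]) f (x - c)%R = \int[mu]_(x in `]0%R, l]) f x.
Proof.
move=> mf f0.
have -> : `]c, (c + l)%R]%classic =
    (fun x : measurableTypeR R => (x - c)%R : measurableTypeR R) @^-1` `]0%R, l].
  by apply/seteqP; split=> x /=; rewrite !in_itv/= subr_gt0 lerBlDl.
have mphi : measurable_fun setT
    (fun x : measurableTypeR R => (x - c)%R : measurableTypeR R).
  by apply: nondecreasing_measurable => // x y xy; rewrite lerB.
rewrite -ge0_integral_pushforward//=; last by move=> y /set_mem; exact: f0.
by apply: eq_measure_integral => A mA _; exact: lebesgue_measure_translate.
Qed.

Lemma ge0_integral_itv_split (l1 l : R) (f : R -> \bar R) :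
  (0 <= l1)%R -> (l1 <= l)%R -> measurable_fun `[0%R, l] f ->
  (forall x, x \in `[0%R, l] -> 0 <= f x) ->
  \int[mu]_(x in `[0%R, l]) f x =
  \int[mu]_(x in `[0%R, l1]) f x + \int[mu]_(x in `]l1, l]) f x.
Proof.
move=> l10 l1l mf f0.
have UE : `[0%R, l]%classic = `[0%R, l1] `|` `]l1, l].
  by rewrite -itv_bndbnd_setU// bnd_simp.
rewrite UE ge0_integral_setU//.
- by rewrite -UE.
- by rewrite -UE.
- apply/disj_setPS => s [/=]; rewrite !in_itv/= => /andP[_ sL1] /andP[].
  by rewrite ltNge sL1.
Qed.

(** Additivity of an arc length integral in abstract form: [f2] is the integrand of the second
    piece, read from its own start. Nothing is asked of [f2] at 0, where the two parametrizations
    may stop at different times. *)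
Lemma ge0_integral_glue (l1 l2 : R) (f f1 f2 : R -> \bar R) :
  (0 <= l1)%R -> (0 <= l2)%R -> measurable_fun `[0%R, (l1 + l2)%R] f ->
  measurable_fun `[0%R, l2] f2 ->
  (forall x, x \in `[0%R, (l1 + l2)%R] -> 0 <= f x) ->
  (forall x, x \in `[0%R, l2] -> 0 <= f2 x) ->
  (forall x, x \in `[0%R, l1] -> f x = f1 x) ->
  (forall x, x \in `]l1, (l1 + l2)%R] -> f x = f2 (x - l1)%R) ->
  \int[mu]_(x in `[0%R, (l1 + l2)%R]) f x =
  \int[mu]_(x in `[0%R, l1]) f1 x + \int[mu]_(x in `[0%R, l2]) f2 x.
Proof.
move=> l10 l20 mf mf2 f0 f20 ff1 ff2.
have sub : `]0%R, l2] `<=` `[0%R, l2].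
  by move=> x /=; rewrite !in_itv/= => /andP[/ltW -> ->].
have mf2' : measurable_fun `]0%R, l2] f2 by exact: measurable_funS mf2.
have l1l : (l1 <= l1 + l2)%R by rewrite lerDl.
rewrite (ge0_integral_itv_split l10 l1l mf f0).
congr (_ + _); first by apply: eq_integral => x /set_mem; exact: ff1.
rewrite -integral_itv_obnd_cbnd// -(@integral_translate l1)//; last first.
  by move=> x /sub; exact: f20.
by apply: eq_integral => x /set_mem; exact: ff2.
Qed.

End translation.

(** * Length of curves *)

Section curve_length.
Context {R : realType} {n : nat}.
Implicit Types (g : R -> 'rV[R]_n) (a b c t : R) (s : seq R).

Fixpoint polygon_length g a s : R :=
  if s is t :: s' then enorm (g t - g a) + polygon_length g t s' else 0.

Lemma polygon_length_cat g a s1 s2 : polygon_length g a (s1 ++ s2) =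
  polygon_length g a s1 + polygon_length g (last a s1) s2.
Proof. by elim: s1 a => [a|t s1 IH a]/=; rewrite ?add0r// IH addrA. Qed.

Lemma polygon_lengthE g a b s :
  \sum_(0 <= i < size s) enorm (g (nth b (a :: s) i.+1) - g (nth b (a :: s) i))
  = polygon_length g a s.
Proof.
elim: s a => [a|t s IH a]/=; first by rewrite big_nil.
by rewrite big_nat_recl//= -IH.
Qed.

Lemma curve_lengthE a b g : curve_length a b g =
  ereal_sup [set (polygon_length g a s)%:E | s in itv_partition a b].
Proof.
by congr ereal_sup; apply/seteqP; split => _ [s sab <-]; exists s;
  rewrite // polygon_lengthE.
Qed.

Lemma curve_length_polygon a b g s : itv_partition a b s ->
  ((polygon_length g a s)%:E <= curve_length a b g)%E.
Proof. by move=> sab; rewrite curve_lengthE; apply: ereal_sup_ubound; exists s. Qed.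

Lemma curve_length_le a b g M :
  (forall s, itv_partition a b s -> ((polygon_length g a s)%:E <= M)%E) ->
  (curve_length a b g <= M)%E.
Proof.
by move=> H; rewrite curve_lengthE; apply: ge_ereal_sup => _ [s sab <-]; exact: H.
Qed.

Lemma curve_lengthxx a g : curve_length a a g = 0%E.
Proof.
apply/eqP; rewrite eq_le; apply/andP; split.
  by apply: curve_length_le => s /itv_partitionxx ->.
by apply: (@curve_length_polygon a a g [::]); split => /=.
Qed.

Lemma curve_length_dist a b g : a <= b ->
  ((enorm (g b - g a))%:E <= curve_length a b g)%E.
Proof.
rewrite le_eqVlt => /predU1P[<-|ab]; first by rewrite curve_lengthxx subrr enorm0.
have := curve_length_polygon g (itv_partition1 ab).
by rewrite /= addr0.
Qed.

Lemma curve_length_ge0 a b g : a <= b -> (0 <= curve_length a b g)%E.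
Proof.
by move=> /(curve_length_dist g); apply: le_trans; rewrite lee_fin enorm_ge0.
Qed.

Lemma eq_curve_length a b g h : a <= b -> {in `[a, b], g =1 h} ->
  curve_length a b g = curve_length a b h.
Proof.
move=> ab gh.
have aux s a' : a' \in `[a, b] -> itv_partition a' b s ->
    polygon_length g a' s = polygon_length h a' s.
  elim: s a' => //= t s IH a' a'ab ps.
  have tab : t \in `[a, b].
    move: (ps) => [/= /andP[a't _] _]; move: a'ab; rewrite !in_itv/= => /andP[aa' _].
    by rewrite (le_trans aa' (ltW a't))/= (itv_partition_le (itv_partition_cons ps)).
  by rewrite IH ?gh//; exact: itv_partition_cons ps.
rewrite !curve_lengthE; congr ereal_sup.
have aab : a \in `[a, b] by rewrite in_itv/= lexx.
by apply/seteqP; split => _ [s sab <-]; exists s => //; rewrite aux.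
Qed.

(** Partitions concatenate; then one supremum is taken at a time. This subtracts lengths, so an
    infinite total length is set apart. *)
Lemma curve_length_addl a b c g : a <= b -> b <= c ->
  (curve_length a b g + curve_length b c g <= curve_length a c g)%E.
Proof.
move=> ab bc.
have aux (s t : seq R) : itv_partition a b s -> itv_partition b c t ->
    ((polygon_length g a s)%:E + (polygon_length g b t)%:E <= curve_length a c g)%E.
  move=> sab tbc; rewrite -EFinD; have := sab => -[_ /eqP lb].
  by rewrite -[X in polygon_length g X t]lb -polygon_length_cat;
    apply/curve_length_polygon/(itv_partition_cat sab).
have ac : (0 <= curve_length a c g)%E by apply: curve_length_ge0; exact: le_trans bc.
have [->|fac] := eqVneq (curve_length a c g) +oo%E; first exact: leey.
have {}fac : curve_length a c g \is a fin_num.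
  by rewrite ge0_fin_numE// lt_neqAle fac leey.
have aux2 s : itv_partition a b s ->
    (curve_length b c g <= curve_length a c g - (polygon_length g a s)%:E)%E.
  move=> sab; apply: curve_length_le => t tbc.
  by rewrite leeBrDr// addeC; exact: aux.
have [s0 s0ab] : exists s, itv_partition a b s.
  move: ab; rewrite le_eqVlt => /predU1P[<-|ab']; last first.
    by exists [:: b]; exact: itv_partition1.
  by exists [::]; split => /=.
have fbc : curve_length b c g \is a fin_num.
  rewrite ge0_fin_numE; last exact: curve_length_ge0.
  apply: le_lt_trans (aux2 _ s0ab) _.
  by rewrite -ge0_fin_numE ?fin_numB ?fac// (le_trans _ (aux2 _ s0ab))//
    curve_length_ge0.
rewrite -leeBrDr//; apply: curve_length_le => s /aux2.
by rewrite !leeBrDr// addeC.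
Qed.

Lemma curve_lengthD b a c g : a <= b -> b <= c ->
  curve_length a c g = (curve_length a b g + curve_length b c g)%E.
Proof.
move=> ab bc; apply/eqP; rewrite eq_le (curve_length_addl g ab bc) andbT.
apply: curve_length_le => s.
elim: s a ab => [|t s IH] a ab sac.
  by rewrite adde_ge0 ?curve_length_ge0.
have tsc := itv_partition_cons sac; have tc := itv_partition_le tsc.
have at_ : a <= t by case: (sac) => /= /andP[/ltW].
rewrite /= EFinD; have [tb|bt] := leP t b.
  apply: (@le_trans _ _ ((enorm (g t - g a))%:E
                         + (curve_length t b g + curve_length b c g))%E).
    by rewrite leeD2l// IH.
  rewrite addeA leeD2r//; apply: le_trans (curve_length_addl g at_ tb).
  by rewrite leeD2r// curve_length_dist.
(* Now [b] lies strictly before [t]: it is inserted as a new partition point between [a] and [t]. *)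
apply: (@le_trans _ _ ((enorm (g b - g a))%:E
     + ((enorm (g t - g b))%:E + (polygon_length g t s)%:E))%E).
  rewrite addeA leeD2r// -EFinD lee_fin [leRHS]addrC; exact: ler_enorm_dist.
rewrite leeD ?curve_length_dist//.
have : itv_partition b c (t :: s).
  by case: tsc => p l; split => //=; rewrite bt.
by move/(curve_length_polygon g); rewrite /= EFinD.
Qed.

Lemma curve_length_mono b' b a g : a <= b' -> b' <= b ->
  (curve_length a b' g <= curve_length a b g)%E.
Proof.
move=> ab' b'b; rewrite (curve_lengthD g ab' b'b) leeDl//.
exact: curve_length_ge0.
Qed.

Lemma rectifiable_sub a b (s t : R) g : a <= s -> s <= t -> t <= b ->
  rectifiable a b g -> rectifiable s t g.
Proof.
rewrite /rectifiable => as_ st tb.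
rewrite (curve_lengthD g as_ (le_trans st tb)) (curve_lengthD g st tb).
apply: le_lt_trans; rewrite addeCA leeDl// adde_ge0 ?curve_length_ge0//.
Qed.

Lemma rectifiable_fin a b g : a <= b -> rectifiable a b g ->
  curve_length a b g \is a fin_num.
Proof. by move=> ab rg; rewrite ge0_fin_numE// curve_length_ge0. Qed.

(** Reversal carries partitions to partitions, and being an involution it needs only one
    inequality. *)
Lemma curve_length_oppr a b g :
  curve_length (- b) (- a) (fun t => g (- t)) = curve_length a b g.
Proof.
(* [rev (belast x s)] is the reversed list of points without its new left end [last x s], as the
   convention for partitions requires. *)
have revE (f : R -> 'rV[R]_n) s x :
    polygon_length f (last x s) (rev (belast x s)) = polygon_length f x s.
  elim: s x => //= t s IH x; rewrite rev_cons -cats1 polygon_length_cat IH /=.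
  rewrite addr0 addrC; congr (_ + _); rewrite enorm_distC.
  have -> // : last (last t s) (rev (belast t s)) = t.
  by case: s {IH} => //= u s; rewrite rev_cons last_rcons.
have oppE (f : R -> 'rV[R]_n) s x :
    polygon_length (fun t => f (- t)) (- x) (map -%R s) = polygon_length f x s.
  by elim: s x => //= t s IH x; rewrite IH !opprK.
have le_ (u v : R) (f : R -> 'rV[R]_n) :
    (curve_length u v f <= curve_length (- v)%R (- u)%R (fun t => f (- t)%R))%E.
  apply: curve_length_le => s suv.
  apply: le_trans (curve_length_polygon _ (itv_partition_rev suv)).
  have [_ /eqP <-] := suv.
  by rewrite lee_fin -last_map revE oppE.
apply/eqP; rewrite eq_le le_ andbT; apply: le_trans (le_ _ _ _) _.
by rewrite !opprK; under eq_fun do rewrite opprK.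
Qed.

End curve_length.

(** * Hitting times of the arc length *)

Section hitting_time.
Context {R : realType} {n : nat}.
Implicit Types (g : R -> 'rV[R]_n) (a b c s t : R).

Definition hitting_time a b g s : R :=
  inf [set t | t \in `[a, b] /\ (s%:E <= curve_length a t g)%E].

Lemma hitting_time_has_inf a b g s : a <= b -> (s%:E <= curve_length a b g)%E ->
  has_inf [set t | t \in `[a, b] /\ (s%:E <= curve_length a t g)%E].
Proof.
move=> ab sL; split; first by exists b; split => //; rewrite in_itv/= ab lexx.
by exists a => t [/itvP ->].
Qed.

Lemma hitting_time_in a b g s : a <= b -> (s%:E <= curve_length a b g)%E ->
  hitting_time a b g s \in `[a, b].
Proof.
move=> ab sL; have [S0 Slb] := hitting_time_has_inf ab sL.
rewrite in_itv/=; apply/andP; split.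
  by apply: lb_le_inf => // t [/itvP ->].
by apply: ge_inf => //; split => //; rewrite in_itv/= ab lexx.
Qed.

Lemma hitting_time_mono a b g s s' : a <= b -> s <= s' ->
  (s'%:E <= curve_length a b g)%E -> hitting_time a b g s <= hitting_time a b g s'.
Proof.
move=> ab ss' s'L; have [S0 _] := hitting_time_has_inf ab s'L.
apply: lb_le_inf => // t [tab s't]; apply: ge_inf.
  by exists a => u [/itvP ->].
by split => //; apply: le_trans s't; rewrite lee_fin.
Qed.

Lemma hitting_time_restrict a b c g s : a <= b -> b <= c ->
  (s%:E <= curve_length a b g)%E -> hitting_time a c g s = hitting_time a b g s.
Proof.
move=> ab bc sL; have [S0 Slb] := hitting_time_has_inf ab sL.
have sL' : (s%:E <= curve_length a c g)%E.
  by apply: le_trans sL _; exact: curve_length_mono.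
have [S0' Slb'] := hitting_time_has_inf (le_trans ab bc) sL'.
apply/eqP; rewrite eq_le; apply/andP; split; apply: lb_le_inf => // t [tab st].
  apply: ge_inf => //; split => //.
  by move: tab; rewrite !in_itv/= => /andP[-> /le_trans ->].
have [tb|bt] := leP t b.
  apply: ge_inf => //; split => //.
  by move: tab; rewrite !in_itv/= => /andP[-> _].
apply: le_trans (ltW bt); apply: ge_inf => //; split => //.
by rewrite in_itv/= ab lexx.
Qed.

(** The inequality is strict because at [s] equal to the length of the first piece, the first
    hitting time may come before [b] when the curve rests there. *)
Lemma hitting_time_shift a b c g s : a <= b -> b <= c -> rectifiable a b g ->
  (curve_length a b g < s%:E)%E ->
  hitting_time a c g s = hitting_time b c g (s - fine (curve_length a b g)).
Proof.
move=> ab bc /(rectifiable_fin ab) fL; rewrite -(fineK fL) lte_fin => Ls.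
congr inf; apply/seteqP; split => t [tab st].
  have bt : b <= t.
    rewrite leNgt; apply/negP => tb; move: st; apply/negP; rewrite -ltNge.
    apply: (@le_lt_trans _ _ (curve_length a b g)).
      by apply: curve_length_mono; rewrite ?(itvP tab)// ltW.
    by rewrite -(fineK fL) lte_fin.
  split; first by rewrite in_itv/= bt (itvP tab).
  by rewrite EFinB fineK// leeBlDr// addeC -curve_lengthD.
have bt : b <= t by rewrite (itvP tab).
split; first by rewrite in_itv/= (le_trans ab bt) (itvP tab).
by move: st; rewrite EFinB fineK// leeBlDr// addeC -curve_lengthD.
Qed.

End hitting_time.

(** * Integrals with respect to arc length *)

Section curve_integral.
Context {R : realType} {n : nat} (rho : 'rV[R]_n -> R).
Implicit Types (g : R -> 'rV[R]_n) (a b c s t : R).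

Definition integrable_along a b g : Prop :=
  [/\ a <= b, rectifiable a b g, (forall t, t \in `[a, b] -> 0 <= rho (g t))
    & {within `[a, b], continuous (rho \o g)}].

Lemma integrable_along_sub a b s t g : a <= s -> s <= t -> t <= b ->
  integrable_along a b g -> integrable_along s t g.
Proof.
move=> as_ st tb [ab rg rho0 cg].
have sub : `[s, t] `<=` `[a, b].
  move=> x /=; rewrite !in_itv/= => /andP[sx xt].
  by rewrite (le_trans as_ sx) (le_trans xt tb).
split => //; first exact: (rectifiable_sub as_ st tb rg).
  by move=> x xst; apply: rho0; exact: sub.
exact: continuous_subspaceW cg.
Qed.

Lemma fine_curve_length_ge0 a b g : a <= b -> 0 <= fine (curve_length a b g).
Proof. by move=> ab; rewrite fine_ge0// curve_length_ge0. Qed.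

Lemma arclength_paramE a b g s :
  arclength_param a b g s = g (hitting_time a b g s).
Proof. by []. Qed.

Lemma arclength_in a b g s : integrable_along a b g ->
  s \in `[0, fine (curve_length a b g)] -> hitting_time a b g s \in `[a, b].
Proof.
move=> [ab rg _ _] sL; apply: hitting_time_in => //.
by rewrite -(fineK (rectifiable_fin ab rg)) lee_fin (itvP sL).
Qed.

Lemma measurable_arclength a b g : integrable_along a b g ->
  measurable_fun `[0, fine (curve_length a b g)]
    (fun s => (rho (arclength_param a b g s))%:E).
Proof.
move=> iab; have [ab rg rho0 cg] := iab; set L := fine _.
have fL := fineK (rectifiable_fin ab rg).
apply/measurable_EFinP.
(* Beyond [L] the infimum defining the hitting time is over the empty set. Capping at [L] makes
   [tau] nondecreasing on the whole line, hence measurable. *)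
pose tau s := hitting_time a b g (Num.min s L).
apply: (@eq_measurable_fun _ _ _ _ _ ((rho \o g) \o tau)).
  move=> s /set_mem sL; rewrite /= /tau min_l//.
  by move: sL; rewrite /= in_itv => /andP[].
apply: (@measurable_comp _ _ _ _ _ _ `[a, b]) => //.
- move=> _ [s /= sL <-]; apply: arclength_in => //.
  by rewrite min_l// (itvP sL).
- exact: subspace_continuous_measurable_fun.
- apply: nondecreasing_measurable => // s t st; apply: hitting_time_mono => //.
    by rewrite le_min !ge_min st lexx orbT.
  by rewrite -fL lee_fin ge_min lexx orbT.
Qed.

Lemma curve_integralD b a c g : a <= b -> b <= c -> integrable_along a c g ->
  curve_integral rho a c g =
  (curve_integral rho a b g + curve_integral rho b c g)%E.
Proof.
move=> ab bc iac.
have iab : integrable_along a b g := integrable_along_sub (lexx a) ab bc iac.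
have ibc : integrable_along b c g := integrable_along_sub ab bc (lexx c) iac.
have [_ rab _ _] := iab; have [_ rbc _ _] := ibc; have [ac rac rho0 _] := iac.
have fab := fineK (rectifiable_fin ab rab).
have fL : fine (curve_length a c g) =
    fine (curve_length a b g) + fine (curve_length b c g).
  by rewrite (curve_lengthD g ab bc) fineD// rectifiable_fin.
have mF := measurable_arclength iac.
have F0 s : s \in `[0, fine (curve_length a c g)] ->
    (0 <= (rho (arclength_param a c g s))%:E)%E.
  by move=> sL; rewrite lee_fin rho0//; exact: arclength_in.
have mF2 := measurable_arclength ibc.
have F20 s : s \in `[0, fine (curve_length b c g)] ->
    (0 <= (rho (arclength_param b c g s))%:E)%E.
  by move=> sL; rewrite lee_fin; have [_ _ + _] := ibc; apply; exact: arclength_in.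
rewrite fL in mF F0.
have E1 s : s \in `[0, fine (curve_length a b g)] ->
    (rho (arclength_param a c g s))%:E = (rho (arclength_param a b g s))%:E.
  move=> sL1; rewrite !arclength_paramE (@hitting_time_restrict _ _ a b)//.
  by rewrite -fab lee_fin (itvP sL1).
have E2 s : s \in `]fine (curve_length a b g), fine (curve_length a b g)
      + fine (curve_length b c g)] ->
    (rho (arclength_param a c g s))%:E =
    (rho (arclength_param b c g (s - fine (curve_length a b g))))%:E.
  move=> sL; rewrite !arclength_paramE (hitting_time_shift ab bc)//.
  by rewrite -fab lte_fin (itvP sL).
rewrite /curve_integral fL.
exact: (ge0_integral_glue (fine_curve_length_ge0 g ab) (fine_curve_length_ge0 g bc)
  mF mF2 F0 F20 E1 E2).
Qed.

Lemma curve_integral_ge0 a b g : integrable_along a b g ->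
  (0 <= curve_integral rho a b g)%E.
Proof.
move=> iab; apply: integral_ge0 => s sL; rewrite lee_fin.
by have [_ _ + _] := iab; apply; exact: arclength_in.
Qed.

Lemma curve_integral_ge a b g m : integrable_along a b g -> 0 <= m ->
  (forall t, t \in `[a, b] -> m <= rho (g t)) ->
  (m%:E * curve_length a b g <= curve_integral rho a b g)%E.
Proof.
move=> iab m0 mrho; have [ab rg _ _] := iab.
have -> : (m%:E * curve_length a b g)%E =
    (\int[@lebesgue_measure R]_(s in `[0%R, fine (curve_length a b g)]) m%:E)%E.
  rewrite integral_cst//= lebesgue_measure_itv/= lte_fin.
  rewrite -[in LHS](fineK (rectifiable_fin ab rg)).
  have := fine_curve_length_ge0 g ab; case: ltP => [_ _|]; first by rewrite sube0.
  by move=> L0 L0'; rewrite (@le_anti _ _ (fine _) 0) ?L0 ?L0'// mule0.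
apply: ge0_le_integral => //.
  exact: measurable_arclength.
by move=> s sL; rewrite lee_fin mrho//; exact: arclength_in.
Qed.

Lemma curve_integral_le a b g M : integrable_along a b g ->
  (forall t, t \in `[a, b] -> rho (g t) <= M) ->
  (curve_integral rho a b g <= M%:E * curve_length a b g)%E.
Proof.
move=> iab mrho; have [ab rg rho0 _] := iab.
have -> : (M%:E * curve_length a b g)%E =
    (\int[@lebesgue_measure R]_(s in `[0%R, fine (curve_length a b g)]) M%:E)%E.
  rewrite integral_cst//= lebesgue_measure_itv/= lte_fin.
  rewrite -[in LHS](fineK (rectifiable_fin ab rg)).
  have := fine_curve_length_ge0 g ab; case: ltP => [_ _|]; first by rewrite sube0.
  by move=> L0 L0'; rewrite (@le_anti _ _ (fine _) 0) ?L0 ?L0'// mule0.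
apply: ge0_le_integral => //.
- by move=> s sL; rewrite lee_fin rho0//; exact: arclength_in.
- exact: measurable_arclength.
- by move=> s sL; rewrite lee_fin mrho//; exact: arclength_in.
Qed.

End curve_integral.

Lemma within_continuousRP {R : realType} (a b : R) (f : R -> R) :
  (forall t, t \in `[a, b] -> forall e, 0 < e -> exists2 h : R, 0 < h &
    forall s, s \in `[a, b] -> `|t - s| < h -> `|f t - f s| < e) ->
  {within `[a, b], continuous f}.
Proof.
move=> H; apply/subspace_continuousP => t tab A /nbhs_ballP[e e0 eA].
have [h h0 hP] := H t tab e e0.
by apply/nbhs_ballP; exists h => //= s ts sab; apply: eA; exact: hP.
Qed.

(* Locked because a failed comparison of two curve integrals would unfold them. *)
Definition qh_length (R : realType) (n : nat) :=
  locked (fun (G : set 'rV[R]_n) (a b : R) (g : R -> 'rV[R]_n) =>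
    curve_integral (fun z => (bdist G z)^-1) a b g).

(** * Quasihyperbolic length of paths *)

Section quasihyperbolic_length.
Context {R : realType} {n : nat} (G : set 'rV[R]_n).
Hypotheses (Gdom : is_domain G) (GT : G <> setT).
Implicit Types (x y z u v w : 'rV[R]_n) (g : R -> 'rV[R]_n) (a b c s t : R).

Local Notation d := (bdist G).
Local Notation J := (qh_length G).

Lemma qh_lengthE a b g : J a b g = curve_integral (fun z => (bdist G z)^-1) a b g.
Proof. by rewrite /qh_length -lock. Qed.

Definition rpath a b g : Prop :=
  [/\ a <= b, {within `[a, b], continuous g}, g @` `[a, b] `<=` G
    & rectifiable a b g].

Lemma rpath_sub a b s t g : a <= s -> s <= t -> t <= b ->
  rpath a b g -> rpath s t g.
Proof.
move=> as_ st tb [ab cg gG rg].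
have sub : `[s, t] `<=` `[a, b].
  move=> x /=; rewrite !in_itv/= => /andP[sx xt].
  by rewrite (le_trans as_ sx) (le_trans xt tb).
split => //; [exact: continuous_subspaceW cg| |exact: (rectifiable_sub as_ st tb)].
by move=> _ [x xst <-]; apply: gG; exists x => //; exact: sub.
Qed.

Lemma rpath_in a b g t : rpath a b g -> t \in `[a, b] -> G (g t).
Proof. by move=> [_ _ gG _] tab; apply: gG; exists t. Qed.

Lemma bdist_near z u h : G z -> enorm (z - u) <= h * d z ->
  (1 - h) * d z <= d u <= (1 + h) * d z.
Proof.
move=> Gz zu.
have H1 := bdist_lip Gdom GT u Gz.
apply/andP; split; last by lra.
have [Gu|nGu] := pselect (G u).
  by have := bdist_lip Gdom GT z Gu; rewrite enorm_distC; lra.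
(* Outside [G] this forces [h >= 1] and the lower bound is at most 0. *)
have : d z <= enorm (z - u).
  by rewrite leNgt; apply/negP => /(bdist_ball Gdom GT Gz).
suff : 0 <= d u by lra.
apply: lb_le_inf; first by case: (bdist_has_inf Gdom GT u Gz).
by move=> _ [w _ <-]; exact: enorm_ge0.
Qed.

Lemma rpath_near a b g t h : 0 < h -> rpath a b g -> t \in `[a, b] ->
  exists2 r : R, 0 < r & forall s, s \in `[a, b] -> `|t - s| < r ->
    enorm (g t - g s) < h * d (g t).
Proof.
move=> h0 pg tab; have [_ /within_continuous_enormP cg _ _] := pg.
by apply: cg => //; rewrite mulr_gt0// (bdist_gt0 Gdom GT)//; exact: rpath_in pg tab.
Qed.

Lemma rpath_integrable a b g : rpath a b g ->
  integrable_along (fun z => (d z)^-1) a b g.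
Proof.
move=> pg; have [ab cg gG rg] := pg; split => //.
  by move=> t tab; rewrite invr_ge0 ltW// (bdist_gt0 Gdom GT)//; exact: rpath_in pg tab.
apply: within_continuousRP => t tab e e0.
have Gt := rpath_in pg tab; have dt := bdist_gt0 Gdom GT Gt.
(* As [h <= 1/2], [d (g s)] is at least half of [d (g t)]; the inverses then differ by at most
   [2 * h / d (g t) <= e / 2]. *)
pose h := Num.min (1 / 2) (e * d (g t) / 4).
have h0 : 0 < h by rewrite lt_min !divr_gt0// mulr_gt0.
have h1 : h <= 1 / 2 by rewrite ge_min lexx.
have h2 : h <= e * d (g t) / 4 by rewrite ge_min lexx orbT.
have [r r0 rP] := rpath_near h0 pg tab.
exists r => // s sab /(rP s sab)/ltW /(bdist_near Gt) /andP[l1 l2].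
have ds : 0 < d (g s) by apply: (bdist_gt0 Gdom GT); exact: rpath_in pg sab.
rewrite /= (_ : (d (g t))^-1 - (d (g s))^-1 =
  (d (g s) - d (g t)) / (d (g t) * d (g s))); last first.
  by field; rewrite !gt_eqF.
rewrite normrM normfV (gtr0_norm (mulr_gt0 dt ds)) ltr_pdivrMr ?mulr_gt0//.
have H : `|d (g s) - d (g t)| <= h * d (g t) by rewrite ler_norml; lra.
apply: le_lt_trans H _; rewrite mulrCA mulrC ltr_pM2l//.
nra.
Qed.

Lemma qh_length_sub a b c g : a <= b -> b <= c -> rpath a c g ->
  J a c g = (J a b g + J b c g)%E.
Proof.
by move=> ab bc /rpath_integrable iac; rewrite !qh_lengthE; exact: curve_integralD.
Qed.

Lemma qh_length_ge0 a b g : rpath a b g -> (0 <= J a b g)%E.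
Proof. by move=> /rpath_integrable iab; rewrite qh_lengthE; exact: curve_integral_ge0. Qed.

Lemma qh_length_ge a b g D : rpath a b g -> 0 < D ->
  (forall t, t \in `[a, b] -> d (g t) <= D) ->
  (D^-1%:E * curve_length a b g <= J a b g)%E.
Proof.
move=> pg D0 dD; rewrite qh_lengthE; apply: curve_integral_ge; first exact: rpath_integrable.
  by rewrite invr_ge0 ltW.
move=> t tab; rewrite lef_pV2 ?posrE//; first exact: dD.
by apply: (bdist_gt0 Gdom GT); exact: rpath_in pg tab.
Qed.

Lemma qh_length_ge_dist a b g D : rpath a b g -> 0 < D ->
  (forall t, t \in `[a, b] -> d (g t) <= D) ->
  ((enorm (g b - g a) / D)%:E <= J a b g)%E.
Proof.
move=> pg D0 dD; apply: le_trans (qh_length_ge pg D0 dD).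
rewrite mulrC EFinM lee_wpmul2l ?lee_fin ?invr_ge0 ?(ltW D0)//.
by apply: curve_length_dist; case: pg.
Qed.

Lemma qh_length_le a b g m : rpath a b g -> 0 < m ->
  (forall t, t \in `[a, b] -> m <= d (g t)) ->
  (J a b g <= m^-1%:E * curve_length a b g)%E.
Proof.
move=> pg m0 dm; rewrite qh_lengthE; apply: curve_integral_le; first exact: rpath_integrable.
by move=> t tab; rewrite lef_pV2 ?posrE ?dm// (lt_le_trans m0)// dm.
Qed.

(** Locally [d] stays above half of its value at [t], so the weighted length is bounded by a
    multiple of the Euclidean length; Cousin's lemma adds up the pieces. *)
Lemma qh_length_fin a b g : rpath a b g -> J a b g \is a fin_num.
Proof.
move=> pg; rewrite ge0_fin_numE; last exact: qh_length_ge0.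
have [ab _ _ _] := pg.
pose Q s t := (J s t g < +oo)%E.
suff : Q a b by [].
apply: (@cousin R Q a b ab).
  rewrite /Q => r s t ar rs st tb rsy sty.
  have prt : rpath r t g := rpath_sub ar (le_trans rs st) tb pg.
  by rewrite (qh_length_sub rs st prt); exact: lte_add_pinfty.
rewrite /Q => t tab; have h0 : 0 < (1 / 2 : R) by rewrite divr_gt0.
have Gt := rpath_in pg tab.
have [h hp hP] := rpath_near h0 pg tab.
exists h => // r s ar rs sb tr ts.
have prs : rpath r s g := rpath_sub ar rs sb pg.
have m0 : 0 < d (g t) / 2 by rewrite divr_gt0// (bdist_gt0 Gdom GT).
apply: (@le_lt_trans _ _ ((d (g t) / 2)^-1%:E * curve_length r s g)%E).
  apply: qh_length_le => // u; rewrite in_itv/= => /andP[ru us].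
  have /andP[] : (1 - 1 / 2) * d (g t) <= d (g u) <= (1 + 1 / 2) * d (g t).
    apply: bdist_near => //; apply/ltW/hP.
      by rewrite in_itv/= (le_trans ar ru) (le_trans us sb).
    by move: tr ts; rewrite !ltr_norml; lra.
  lra.
have [_ _ _ rg] := prs.
by rewrite lte_mul_pinfty// lee_fin invr_ge0 ltW.
Qed.

Lemma rpath_oppr a b g : rpath a b g -> rpath (- b) (- a) (fun t => g (- t)).
Proof.
move=> [ab /within_continuous_enormP cg gG rg]; split.
- by rewrite lerN2.
- apply/within_continuous_enormP => t tab e e0.
  have [|h h0 hP] := cg (- t) _ e e0; first by rewrite oppr_itvcc.
  exists h => // s sab ts; apply: hP; first by rewrite oppr_itvcc.
  by rewrite -opprD normrN.
- move=> _ [t tab <-]; apply: gG; exists (- t) => //=.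
  by rewrite oppr_itvcc.
- by rewrite /rectifiable curve_length_oppr.
Qed.

(** No change of variables: on short pieces [d] is constant up to a factor [1 + e], so both weighted
    lengths are compared with the Euclidean length, which is invariant under reversal. Cousin's
    lemma sums the pieces, and [e] tends to 0. *)
Lemma qh_length_oppr_le a b g : rpath a b g ->
  (J (- b)%R (- a)%R (fun t => g (- t)%R) <= J a b g)%E.
Proof.
move=> pg; have [ab _ _ _] := pg.
have H (e : R) : 0 < e ->
    (J (- b)%R (- a)%R (fun t => g (- t)%R) <= (1 + e)%:E * J a b g)%E.
  move=> e0.
  have e1 : 0 <= 1 + e by lra.
  pose Q s t := (J (- t)%R (- s)%R (fun t => g (- t)%R) <= (1 + e)%:E * J s t g)%E.
  suff : Q a b by [].
  apply: (@cousin R Q a b ab).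
    rewrite /Q => r s t ar rs st tb Qrs Qst.
    have prt : rpath r t g := rpath_sub ar (le_trans rs st) tb pg.
    have prs : rpath r s g := rpath_sub (lexx r) rs st prt.
    have pst : rpath s t g := rpath_sub rs st (lexx t) prt.
    have [ts' sr'] : - t <= - s /\ - s <= - r by rewrite !lerN2.
    rewrite (qh_length_sub rs st prt) (qh_length_sub ts' sr' (rpath_oppr prt)).
    rewrite addeC ge0_muleDr; [exact: leeD|exact: qh_length_ge0|exact: qh_length_ge0].
  (* With [h = e / (2 + e)] the oscillation [(1 + h) / (1 - h)] of [d] is exactly [1 + e]. *)
  rewrite /Q => t tab; have e2 : 0 < e / (2 + e) by rewrite divr_gt0//; lra.
  have Gt := rpath_in pg tab; have dt := bdist_gt0 Gdom GT Gt.
  have e3 : (1 - e / (2 + e)) * (2 + e) = 2 by field; lra.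
  have e4 : (1 + e / (2 + e)) * (2 + e) = 2 * (1 + e) by field; lra.
  have e5 : 0 < 1 - e / (2 + e) by nra.
  have e6 : 1 + e / (2 + e) = (1 + e) * (1 - e / (2 + e)) by field; lra.
  have [h hp hP] := rpath_near e2 pg tab.
  exists h => // r s ar rs sb tr ts.
  have prs : rpath r s g := rpath_sub ar rs sb pg.
  have near (u : R) : u \in `[r, s] ->
      (1 - e / (2 + e)) * d (g t) <= d (g u) <= (1 + e / (2 + e)) * d (g t).
    rewrite in_itv/= => /andP[ru us]; apply: bdist_near => //; apply/ltW/hP.
      by rewrite in_itv/= (le_trans ar ru) (le_trans us sb).
    by move: tr ts; rewrite !ltr_norml; lra.
  apply: (@le_trans _ _ (((1 - e / (2 + e)) * d (g t))^-1%:E * curve_length r s g)%E).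
    rewrite -(curve_length_oppr r s g); apply: qh_length_le.
    - exact: rpath_oppr.
    - by rewrite mulr_gt0.
    - by move=> u; rewrite -oppr_itvcc => /near /andP[].
  apply: (@le_trans _ _ ((1 + e)%:E *
      (((1 + e / (2 + e)) * d (g t))^-1%:E * curve_length r s g))%E).
    rewrite muleA -EFinM e6 le_eqVlt; apply/orP; left; apply/eqP; congr (_%:E * _)%E.
    by field; rewrite !gt_eqF//; lra.
  rewrite lee_wpmul2l ?lee_fin//; apply: qh_length_ge => //.
    by rewrite mulr_gt0// e6 mulr_gt0//; lra.
  by move=> u /near /andP[].
have fJ := qh_length_fin pg; have J0 := qh_length_ge0 pg.
rewrite -(fineK fJ) in H J0 *; set j := fine _ in H J0 *.
apply/lee_addgt0Pr => e e0; rewrite lee_fin in J0.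
have j1 : 0 < j + 1 by lra.
(* A relative error [e / (j + 1)] of the value [j] is an absolute error of at most [e], also when
   [j = 0]. *)
apply: le_trans (H (e / (j + 1)) _) _; first by rewrite divr_gt0.
rewrite -EFinM -EFinD lee_fin mulrDl mul1r lerD2l mulrAC.
by rewrite ler_pdivrMr// ler_wpM2l ?(ltW e0)//; lra.
Qed.

Lemma qh_length_oppr a b g : rpath a b g ->
  J (- b) (- a) (fun t => g (- t)) = J a b g.
Proof.
move=> pg; apply/eqP; rewrite eq_le qh_length_oppr_le//=.
have := qh_length_oppr_le (rpath_oppr pg).
by rewrite !opprK; under eq_fun do rewrite opprK.
Qed.

End quasihyperbolic_length.

Lemma curve_length_lip {R : realType} {n : nat} (a b K : R) (g : R -> 'rV[R]_n) :
  (forall s t, s \in `[a, b] -> t \in `[a, b] ->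
     enorm (g t - g s) <= K * `|t - s|) ->
  (curve_length a b g <= (K * (b - a))%:E)%E.
Proof.
move=> lipg; apply: curve_length_le => s sab; rewrite lee_fin.
have aux : forall (s : seq R) a', a' \in `[a, b] -> itv_partition a' b s ->
    polygon_length g a' s <= K * (b - a').
  elim=> [|t l IH] a' a'ab p /=.
    by rewrite (itv_partition_nil p) subrr mulr0.
  have pl := itv_partition_cons p; have tb := itv_partition_le pl.
  have a't : a' < t by case: p => /= /andP[].
  have tab : t \in `[a, b].
    by rewrite in_itv/= tb (le_trans _ (ltW a't))// (itvP a'ab).
  have := IH t tab pl; have := lipg _ _ a'ab tab.
  rewrite gtr0_norm ?subr_gt0//; lra.
by apply: aux => //; rewrite in_itv/= lexx (itv_partition_le sab).
Qed.

(** * Quasihyperbolic distance: symmetry, local estimates and chains *)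

Section quasihyperbolic_distance.
Context {R : realType} {n : nat} (G : set 'rV[R]_n).
Hypotheses (Gdom : is_domain G) (GT : G <> setT).
Implicit Types (x y z u v w : 'rV[R]_n) (g : R -> 'rV[R]_n) (a b c s t : R).

Local Notation d := (bdist G).
Local Notation J := (qh_length G).
Local Notation k := (qh_dist G).

Lemma rpath_extend a b g v : rpath G a b g ->
  (forall t, t \in `[0, 1] -> G (g b + t *: (v - g b))) ->
  exists2 h : R -> 'rV[R]_n, rpath G a (b + 1) h & h a = g a /\
    forall t, t \in `[b, b + 1] -> h t = g b + (t - b) *: (v - g b).
Proof.
move=> [ab /within_continuous_enormP cg gG rg] segG.
(* Clamping puts the path and the added segment in one formula, so that continuity is the sum of two
   estimates. *)
pose h t := g (Num.min t b) + (Num.max t b - b) *: (v - g b).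
have hl t : t <= b -> h t = g t.
  by move=> tb; rewrite /h min_l// max_r// subrr scale0r addr0.
have hr t : b <= t -> h t = g b + (t - b) *: (v - g b).
  by move=> tb; rewrite /h min_r// max_l.
have lenr : (curve_length b (b + 1) h <= (enorm (v - g b))%:E)%E.
  have -> : enorm (v - g b) = enorm (v - g b) * (b + 1 - b) by ring.
  apply: curve_length_lip => s t; rewrite !in_itv/= => /andP[bs _] /andP[bt _].
  rewrite !hr// opprD addrACA subrr add0r -scalerBl enormZ mulrC.
  by rewrite (_ : t - b - (s - b) = t - s)//; ring.
have hG : h @` `[a, b + 1] `<=` G.
  move=> _ [t /= tab <-]; move: tab; rewrite in_itv/= => /andP[at_ tb].
  have [tb'|/ltW bt] := leP t b.
    by rewrite hl//; apply: gG; exists t => //=; rewrite in_itv/= at_.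
  by rewrite hr//; apply: segG; rewrite in_itv/= subr_ge0 bt lerBlDl.
have ab1 : a <= b + 1 by lra.
have b1 : b <= b + 1 by lra.
exists h; last first.
  by split=> [|t]; [rewrite hl|rewrite in_itv/= => /andP[bt _]; rewrite hr].
split => //; last first.
  rewrite /rectifiable (curve_lengthD h ab b1) lte_add_pinfty//; last first.
    by apply: le_lt_trans lenr _; exact: ltry.
  rewrite (@eq_curve_length _ _ _ _ _ g)// => t.
  by rewrite in_itv/= => /andP[_]; exact: hl.
apply/within_continuous_enormP => t tab e e0.
have mab s : s \in `[a, b + 1] -> Num.min s b \in `[a, b].
  by rewrite !in_itv/= => /andP[as_ _]; rewrite le_min as_ ab ge_min lexx orbT.
have e2 : 0 < e / 2 by rewrite divr_gt0.
have [r r0 rP] := cg _ (mab t tab) _ e2.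
have v1 : 0 < enorm (v - g b) + 1 by rewrite ltr_wpDl// enorm_ge0.
pose r' := Num.min r (e / 2 / (enorm (v - g b) + 1)).
have r'r : r' <= r by rewrite ge_min lexx.
have r'e : r' * (enorm (v - g b) + 1) <= e / 2.
  by rewrite -ler_pdivlMr// ge_min lexx orbT.
exists r'; first by rewrite lt_min r0 !divr_gt0.
move=> s sab ts.
have dmin : `|Num.min t b - Num.min s b| <= `|t - s|.
  by case: (leP t b); case: (leP s b); rewrite ?subrr ?normr0// => *;
    rewrite ler_norml; have := ler_norm (t - s); have := ler_norm (s - t);
    rewrite (distrC s); lra.
have dmax : `|Num.max t b - Num.max s b| <= `|t - s|.
  by case: (leP t b); case: (leP s b); rewrite ?subrr ?normr0// => *;
    rewrite ler_norml; have := ler_norm (t - s); have := ler_norm (s - t);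
    rewrite (distrC s); lra.
have H1 := rP _ (mab s sab) (le_lt_trans dmin (lt_le_trans ts r'r)).
have -> : h t - h s = (g (Num.min t b) - g (Num.min s b))
    + (Num.max t b - Num.max s b) *: (v - g b).
  rewrite /h opprD addrACA -scalerBl; congr (_ + _ *: _); ring.
apply: le_lt_trans (ler_enormD _ _) _; rewrite enormZ.
have := ler_wpM2r (enorm_ge0 (v - g b)) dmax.
have := enorm_ge0 (v - g b); nra.
Qed.

Lemma rpath_cst x : G x -> rpath G 0 0 (fun=> x).
Proof.
move=> Gx; split => //.
- apply/within_continuous_enormP => t _ e e0; exists 1 => // s _ _.
  by rewrite subrr enorm0.
- by move=> _ [t _ <-].
- by rewrite /rectifiable curve_lengthxx.
Qed.

Lemma ball_segment z r u v t : enorm (z - u) < r -> enorm (z - v) < r ->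
  t \in `[0, 1] -> enorm (z - (u + t *: (v - u))) < r.
Proof.
rewrite in_itv/= => zu zv /andP[t0 t1].
have -> : z - (u + t *: (v - u)) = (1 - t) *: (z - u) + t *: (z - v).
  by apply/rowP => i; rewrite !mxE; ring.
apply: le_lt_trans (ler_enormD _ _) _; rewrite !enormZ ger0_norm ?subr_ge0//.
rewrite ger0_norm//.
pose M := Num.max (enorm (z - u)) (enorm (z - v)).
apply: (@le_lt_trans _ _ M); last by rewrite gt_max zu.
have H1 : (1 - t) * enorm (z - u) <= (1 - t) * M.
  by rewrite ler_wpM2l ?subr_ge0// le_max lexx.
have H2 : t * enorm (z - v) <= t * M by rewrite ler_wpM2l// le_max lexx orbT.
lra.
Qed.

Lemma rpath_exists x y : G x -> G y ->
  exists a b g, [/\ rpath G a b g, g a = x & g b = y].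
Proof.
move=> Gx; move: y.
(* Moving inside one ball from any [u] to any [v] gives both directions of the local invariance. *)
have ext z u v : G z -> enorm (z - u) < d z -> enorm (z - v) < d z ->
    (exists a b g, [/\ rpath G a b g, g a = x & g b = u]) ->
    exists a b g, [/\ rpath G a b g, g a = x & g b = v].
  move=> Gz zu zv [a [b [g [pg gx gu]]]].
  have [|h ph [ha hE]] := @rpath_extend a b g v pg.
    move=> t t01; apply: (bdist_ball Gdom GT Gz).
    by rewrite gu; exact: ball_segment.
  exists a, (b + 1), h; split => //; first by rewrite ha.
  rewrite hE ?in_itv/= ?lerDl ?ler01 ?lexx//.
  by rewrite (_ : b + 1 - b = 1) ?scale1r; [rewrite addrC subrK|ring].
apply: (is_domain_ind Gdom Gx); first by exists 0, 0, (fun=> x); split => //; exact: rpath_cst.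
move=> z Gz; have dz := bdist_gt0 Gdom GT Gz.
exists (d z) => // v zv; split; apply: (ext z) => //; rewrite subrr enorm0//.
Qed.

Lemma qh_dist_lengthE x y : k x y = fine (ereal_inf [set L | exists a b g,
  [/\ rpath G a b g, g a = x, g b = y & L = J a b g]]).
Proof.
congr (fine (ereal_inf _)); apply/seteqP; split=> [L|L].
  move=> [a [b [g [[ab cg gG gx gy] rg ->]]]]; exists a, b, g.
  by rewrite qh_lengthE; split.
move=> [a [b [g [[ab cg gG rg] gx gy ->]]]]; exists a, b, g.
by rewrite qh_lengthE; split.
Qed.

Lemma qh_dist_inf_ge0 x y : (0 <= ereal_inf [set L | exists a b g,
  [/\ rpath G a b g, g a = x, g b = y & L = J a b g]])%E.
Proof.
apply: le_ereal_inf_tmp => _ [a [b [g [pg _ _ ->]]]].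
exact: (qh_length_ge0 Gdom GT).
Qed.

Lemma qh_dist_ge0 x y : 0 <= k x y.
Proof. by rewrite qh_dist_lengthE fine_ge0// qh_dist_inf_ge0. Qed.

Lemma qh_dist_le a b g : rpath G a b g -> ((k (g a) (g b))%:E <= J a b g)%E.
Proof.
move=> pg; rewrite qh_dist_lengthE.
set S := (X in ereal_inf X).
have SJ : (ereal_inf S <= J a b g)%E by apply: ereal_inf_lbound; exists a, b, g.
rewrite fineK// ge0_fin_numE; last exact: qh_dist_inf_ge0.
by apply: le_lt_trans SJ _; rewrite -ge0_fin_numE ?(qh_length_fin Gdom GT)//
  (qh_length_ge0 Gdom GT).
Qed.

Lemma qh_dist_approx x y e : G x -> G y -> 0 < e -> exists a b g,
  [/\ rpath G a b g, g a = x, g b = y & (J a b g <= (k x y + e)%:E)%E].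
Proof.
move=> Gx Gy e0; have [a [b [g [pg gx gy]]]] := rpath_exists Gx Gy.
have := qh_dist_le pg; rewrite gx gy qh_dist_lengthE.
set S := (X in ereal_inf X) => SJ.
have fS : ereal_inf S \is a fin_num.
  rewrite ge0_fin_numE; last exact: qh_dist_inf_ge0.
  apply: (@le_lt_trans _ _ (J a b g)).
    by apply: ereal_inf_lbound; exists a, b, g.
  by rewrite -ge0_fin_numE ?(qh_length_fin Gdom GT)// (qh_length_ge0 Gdom GT).
have [_ [a' [b' [g' [pg' gx' gy' ->]]]] lt_] := lb_ereal_inf_adherent e0 fS.
exists a', b', g'; split => //; apply: ltW.
by rewrite EFinD fineK.
Qed.

Lemma qh_distC x y : G x -> G y -> k x y = k y x.
Proof.
move=> Gx Gy.
suff H u v : G u -> G v -> k u v <= k v u by apply/eqP; rewrite eq_le !H.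
move=> Gu Gv; apply/ler_addgt0Pr => e e0.
have [a [b [g [pg ga gb Jk]]]] := qh_dist_approx Gv Gu e0.
rewrite -lee_fin; apply: le_trans Jk; rewrite -(qh_length_oppr Gdom GT pg).
have := qh_dist_le (rpath_oppr pg).
by rewrite /= !opprK ga gb.
Qed.

(** The straight segment is a competitor along which [d] stays above [d x / 2]. *)
Lemma qh_dist_near_le x y : G x -> enorm (x - y) <= d x / 2 ->
  k x y <= 2 * enorm (x - y) / d x.
Proof.
move=> Gx xy; have dx := bdist_gt0 Gdom GT Gx.
have seg t : t \in `[0, 1] -> enorm (x - (x + t *: (y - x))) <= enorm (x - y).
  rewrite in_itv/= => /andP[t0 t1].
  have -> : x - (x + t *: (y - x)) = t *: (x - y).
    by apply/rowP => i; rewrite !mxE; ring.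
  by rewrite enormZ ger0_norm// ler_piMl// enorm_ge0.
have [|h ph [h0 hE]] := @rpath_extend 0 0 (fun=> x) y (rpath_cst Gx).
  move=> t t01; apply: (bdist_ball Gdom GT Gx).
  by apply: (le_lt_trans (seg t t01)); lra.
rewrite add0r in ph hE.
have {}hE t : t \in `[0, 1] -> h t = x + t *: (y - x).
  by move=> /hE ->; rewrite subr0.
have h1 : h 1 = y by rewrite hE ?in_itv/= ?ler01 ?lexx// scale1r addrC subrK.
have := qh_dist_le ph; rewrite h0 h1 -lee_fin => /le_trans; apply.
have len : (curve_length 0 1 h <= (enorm (x - y))%:E)%E.
  have -> : enorm (x - y) = enorm (x - y) * (1 - 0) by ring.
  apply: curve_length_lip => s t s01 t01.
  rewrite !hE// opprD addrACA subrr add0r -scalerBl enormZ mulrC.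
  by rewrite (enorm_distC y).
apply: (@le_trans _ _ ((d x / 2)^-1%:E * curve_length 0 1 h)%E).
  apply: (qh_length_le Gdom GT ph); first by rewrite divr_gt0.
  move=> t t01; have := @bdist_near _ _ _ Gdom GT x (h t) (1 / 2) Gx.
  have := seg t t01; rewrite -hE// => seg1.
  have : enorm (x - h t) <= 1 / 2 * d x by lra.
  by move=> /[swap] /[apply] /andP[]; lra.
apply: (@le_trans _ _ ((d x / 2)^-1%:E * (enorm (x - y))%:E)%E).
  by rewrite lee_wpmul2l// lee_fin invr_ge0 divr_ge0// ltW.
rewrite -EFinM lee_fin le_eqVlt; apply/orP; left; apply/eqP; field.
by rewrite gt_eqF.
Qed.

(** The first exit time from the ball of radius [r]: limits from the right give the lower bound
    there, limits from the left the upper bound. *)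
Lemma rpath_exit a b g r : rpath G a b g -> 0 < r -> r <= enorm (g b - g a) ->
  exists2 t, t \in `[a, b] & r <= enorm (g t - g a) /\
    forall s, s \in `[a, t] -> enorm (g s - g a) <= r.
Proof.
move=> [ab /within_continuous_enormP cg _ _] r0 rb.
pose E := [set t | t \in `[a, b] /\ r <= enorm (g t - g a)].
have E0 : E !=set0 by exists b; split => //; rewrite in_itv/= ab lexx.
have iE : has_inf E by split => //; exists a => t [/itvP ->].
have aT : a <= inf E by apply: lb_le_inf => // t [/itvP ->].
have Tb : inf E <= b.
  by apply: ge_inf; [case: iE|split => //; rewrite in_itv/= ab lexx].
have Tab : inf E \in `[a, b] by rewrite in_itv/= aT.
have below s : s \in `[a, b] -> s < inf E -> enorm (g s - g a) < r.
  move=> sab sT; rewrite ltNge; apply/negP => rs.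
  by move: sT; apply/negP; rewrite -leNgt; apply: ge_inf; [case: iE|].
exists (inf E) => //; split.
  apply/ler_addgt0Pr => e e0; have [h h0 hP] := cg _ Tab _ e0.
  have [t [tab rt] tT] := inf_adherent h0 iE.
  have Tt : inf E <= t by apply: ge_inf; [case: iE|].
  have := hP t tab; rewrite distrC ger0_norm ?subr_ge0// => /(_ _)/ltW Tt'.
  have {}Tt' : enorm (g (inf E) - g t) <= e by apply: Tt'; lra.
  have := ler_enorm_dist (g (inf E)) (g t) (g a).
  by rewrite (enorm_distC (g t) (g (inf E))); lra.
move=> s; rewrite in_itv/= => /andP[as_].
rewrite le_eqVlt => /predU1P[->|sT]; last first.
  by apply/ltW/below => //; rewrite in_itv/= as_ ltW// (lt_le_trans sT).
have aT' : a < inf E.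
  rewrite lt_def aT andbT; apply/eqP => Ea.
  have [t [tab rt] tT] : exists2 t, E t & t < inf E + 1.
    by apply: inf_adherent.
  have [h h0 hP] := cg _ Tab _ r0.
  have [t' [tab' rt'] tT'] := inf_adherent h0 iE.
  have Tt : inf E <= t' by apply: ge_inf; [case: iE|].
  have : enorm (g (inf E) - g t') < r.
    by apply: hP => //; rewrite distrC ger0_norm ?subr_ge0//; lra.
  by rewrite Ea enorm_distC; lra.
apply/ler_addgt0Pr => e e0; have [h h0 hP] := cg _ Tab _ e0.
pose q := Num.max a (inf E - h / 2).
have qT : q < inf E by rewrite gt_max aT'/=; lra.
have aq : a <= q by rewrite le_max lexx.
have qab : q \in `[a, b] by rewrite in_itv/= aq ltW// (lt_le_trans qT).
have qh : inf E - h / 2 <= q by rewrite le_max lexx orbT.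
have : enorm (g (inf E) - g q) < e.
  by apply: hP => //; rewrite gtr0_norm ?subr_gt0//; lra.
have := below _ qab qT; have := ler_enorm_dist (g q) (g (inf E)) (g a); lra.
Qed.

(** Up to the exit time the Lipschitz bound gives [d <= d (g a) + r], while the displacement is at
    least [r]. *)
Lemma rpath_exit_length a b g r : rpath G a b g -> 0 < r ->
  r <= enorm (g b - g a) -> exists2 t, t \in `[a, b] &
    enorm (g t - g a) <= r /\ ((r / (d (g a) + r))%:E <= J a t g)%E.
Proof.
move=> pg r0 rb; have [t tab [rt tr]] := rpath_exit pg r0 rb.
have [at_ tb] : a <= t /\ t <= b by rewrite !(itvP tab).
have pt : rpath G a t g := rpath_sub (lexx a) at_ tb pg.
have Ga : G (g a) by apply: (rpath_in pt); rewrite in_itv/= lexx.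
have da := bdist_gt0 Gdom GT Ga.
exists t => //; split; first by apply: tr; rewrite in_itv/= lexx at_.
have D0 : 0 < d (g a) + r by rewrite addr_gt0.
apply: le_trans (qh_length_ge_dist Gdom GT pt D0 _).
  by rewrite lee_fin ler_wpM2r// invr_ge0 ltW.
move=> s /tr; rewrite enorm_distC; have := bdist_lip Gdom GT (g s) Ga; lra.
Qed.

Lemma qh_dist_ge x y r : G x -> G y -> 0 < r -> r <= enorm (y - x) ->
  r / (d x + r) <= k x y.
Proof.
move=> Gx Gy r0 rxy; apply/ler_addgt0Pr => e e0.
have [a [b [g [pg ga gb Jk]]]] := qh_dist_approx Gx Gy e0.
have [|t tab [_ rJ]] := @rpath_exit_length a b g r pg r0; first by rewrite ga gb.
have [at_ tb] : a <= t /\ t <= b by rewrite !(itvP tab).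
rewrite -lee_fin; apply: le_trans Jk; rewrite ga in rJ; apply: (le_trans rJ).
rewrite (qh_length_sub Gdom GT at_ tb pg) leeDl//.
exact: (qh_length_ge0 Gdom GT (rpath_sub at_ tb (lexx b) pg)).
Qed.

(** Greedy cutting: a new point is placed whenever the path leaves the ball of radius [d / 8] around
    the last one. That costs [(1/8) / (1 + 1/8) = 1/9], so a budget of [m / 9] allows at most [m]
    cuts. *)
Lemma rpath_chain (m : nat) a b g : rpath G a b g -> (J a b g <= (m%:R / 9)%:E)%E ->
  exists (N : nat) (T : nat -> R), [/\ T 0 = a,
    forall j, (j <= N)%N -> T j \in `[a, b],
    forall j, (j < N)%N -> [/\ T j <= T j.+1,
      enorm (g (T j.+1) - g (T j)) <= d (g (T j)) / 8
      & ((1 / 9)%:E <= J (T j) (T j.+1) g)%E]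
    & enorm (g b - g (T N)) <= d (g (T N)) / 8].
Proof.
elim: m a => [|m IH] a pg Jm.
all: have [ab _ _ _] := pg.
all: have Ga : G (g a) by apply: (rpath_in pg); rewrite in_itv/= lexx.
all: have da := bdist_gt0 Gdom GT Ga.
all: have da8 : 0 < d (g a) / 8 by rewrite divr_gt0.
all: have [le8|/ltW gt8] := leP (enorm (g b - g a)) (d (g a) / 8).
1,3: by exists 0, (fun=> a); split => // j _; rewrite in_itv/= lexx.
all: have [t tab [gt tJ]] := rpath_exit_length pg da8 gt8.
all: have {}tJ : ((1 / 9)%:E <= J a t g)%E.
1,3: by apply: le_trans tJ; rewrite lee_fin le_eqVlt; apply/orP; left; apply/eqP;
  field; rewrite gt_eqF//; lra.
all: have [at_ tb] : a <= t /\ t <= b by rewrite !(itvP tab).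
all: have pt : rpath G t b g := rpath_sub at_ tb (lexx b) pg.
all: rewrite (qh_length_sub Gdom GT at_ tb pg) in Jm.
  have := le_trans (leeDl _ (qh_length_ge0 Gdom GT pt)) Jm.
  by move=> /(le_trans tJ); rewrite lee_fin mul0r; lra.
have [|N [T [T0 Tin Tstep Tend]]] := IH t pt.
  rewrite -(fineK (qh_length_fin Gdom GT pt)) in Jm *.
  have := le_trans (leeD2r _ tJ) Jm.
  by rewrite -EFinD !lee_fin -natr1; lra.
exists N.+1, (fun j => if j is j'.+1 then T j' else a); split => //.
- move=> [|j] jN; first by rewrite in_itv/= lexx.
  by have := Tin j jN; rewrite !in_itv/= => /andP[/(le_trans at_) -> ->].
- move=> [|j] jN; last exact: Tstep.
  by rewrite T0.
Qed.

(** [al j] is the quasihyperbolic length of the path up to [p j]. It replaces [k z (p j)] as a clock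
    because it advances by at least 1/9 at every step. *)
Lemma qh_chain z w : G z -> G w ->
  exists (N : nat) (p : nat -> 'rV[R]_n) (al : nat -> R), [/\ p 0 = z,
    forall j, (j <= N)%N ->
      [/\ G (p j), j%:R / 9 <= al j, k z (p j) <= al j & k (p j) w <= k z w + 1 - al j],
    forall j, (j < N)%N ->
      enorm (p j.+1 - p j) <= d (p j) / 8 /\ al j + 1 / 9 <= al j.+1
    & enorm (w - p N) <= d (p N) / 8].
Proof.
move=> Gz Gw; have [a [b [g [pg ga gb Jk]]]] := qh_dist_approx Gz Gw ltr01.
have J0 := qh_length_ge0 Gdom GT pg; have Jf := fineK (qh_length_fin Gdom GT pg).
pose m := Num.truncn (fine (J a b g) * 9).
have Jm : (J a b g <= (m.+1%:R / 9)%:E)%E.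
  rewrite -Jf lee_fin ler_pdivlMr//; apply/ltW/truncnS_gt.
have [N [T [T0 Tin Tstep Tend]]] := rpath_chain pg Jm.
have p1 j : (j <= N)%N -> rpath G a (T j) g.
  by move=> /Tin Tj; apply: rpath_sub pg => //; rewrite (itvP Tj).
have p2 j : (j <= N)%N -> rpath G (T j) b g.
  by move=> /Tin Tj; apply: rpath_sub pg => //; rewrite (itvP Tj).
pose al j := fine (J a (T j) g).
have alE j : (j <= N)%N -> (al j)%:E = J a (T j) g.
  by move=> jN; rewrite fineK// (qh_length_fin Gdom GT)//; exact: p1.
have als j : (j < N)%N -> al j + 1 / 9 <= al j.+1.
  move=> jN; have [TT _ stp] := Tstep j jN.
  rewrite -lee_fin EFinD !alE//; last exact: ltnW.
  have aT : a <= T j by rewrite (itvP (Tin j (ltnW jN))).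
  by rewrite (qh_length_sub Gdom GT aT TT (p1 _ jN)) leeD2l.
exists N, (g \o T), al; split => //=.
- by rewrite T0.
- move=> j jN; split.
  + exact: (rpath_in pg (Tin j jN)).
  + elim: j jN => [|j IH] jN.
      rewrite mul0r -lee_fin alE// (qh_length_ge0 Gdom GT)//; exact: p1.
    by have := IH (ltnW jN); have := als j jN; rewrite -natr1; lra.
  + by rewrite -lee_fin alE// -ga; exact: qh_dist_le (p1 _ jN).
  + have aT : a <= T j by rewrite (itvP (Tin j jN)).
    have Tb : T j <= b by rewrite (itvP (Tin j jN)).
    have := qh_dist_le (p2 _ jN); rewrite gb.
    move: Jk; rewrite (qh_length_sub Gdom GT aT Tb pg) -alE//.
    rewrite -(fineK (qh_length_fin Gdom GT (p2 _ jN))) -EFinD !lee_fin; lra.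
- by move=> j jN; have [_ ? _] := Tstep j jN; split => //; exact: als.
- by rewrite -gb.
Qed.

End quasihyperbolic_distance.

(** * Frink's chain construction for quasi-metrics *)

Section frink.
Context {R : realType} {T : Type} (X : set T) (A : T -> T -> R).
Hypotheses (A0 : forall x y, 0 <= A x y)
  (A2 : forall x y z c, X x -> X y -> X z -> A x y <= c -> A y z <= c ->
     A x z <= 2 * c)
  (A3 : forall x y z w c, X x -> X y -> X z -> X w ->
     A x y <= c -> A y z <= c -> A z w <= c -> A x w <= 2 * c).
Implicit Types (x y : T) (s : seq T).

Fixpoint chain_sum x s : R :=
  if s is y :: s' then A x y + chain_sum y s' else 0.

Fixpoint chain_in s : Prop := if s is y :: s' then X y /\ chain_in s' else True.

Lemma chain_sum_ge0 x s : 0 <= chain_sum x s.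
Proof. by elim: s x => //= y s IH x; rewrite addr_ge0. Qed.

Lemma chain_sum_cat x s1 s2 :
  chain_sum x (s1 ++ s2) = chain_sum x s1 + chain_sum (last x s1) s2.
Proof. by elim: s1 x => [x|y s1 IH x]/=; rewrite ?add0r// IH addrA. Qed.

Lemma chain_in_cat s1 s2 : chain_in (s1 ++ s2) <-> chain_in s1 /\ chain_in s2.
Proof. by elim: s1 => [|y s1 IH]/=; tauto. Qed.

Lemma chain_in_last x s : X x -> chain_in s -> X (last x s).
Proof. by elim: s x => //= y s IH x _ [Xy Xs]; exact: IH. Qed.

(** Cuts at the step that carries the partial sum past [c]. With [c] half of the total, both [s1]
    and the rest after [z] sum to at most one half. *)
Lemma chain_split x y s c : 0 <= c -> exists s1 z s2,
  [/\ y :: s = s1 ++ z :: s2, chain_sum x s1 <= c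
    & s2 = [::] \/ c < chain_sum x s1 + A (last x s1) z].
Proof.
elim: s x y c => [|y' s IH] x y c c0.
  by exists [::], y, [::]; split => //; left.
have [xyc|cxy] := leP (A x y) c; last first.
  by exists [::], y, (y' :: s); split => //=; right; rewrite add0r.
have [|s1 [z [s2 [E le1 or2]]]] := IH y y' (c - A x y); first by rewrite subr_ge0.
exists (y :: s1), z, s2; split => /=; first by rewrite E.
  by rewrite -lerBrDl.
by case: or2 => [->|lt2]; [left|right; rewrite -addrA -ltrBlDl].
Qed.

Lemma frink x y s : X x -> chain_in (y :: s) ->
  A x (last y s) <= 2 * chain_sum x (y :: s).
Proof.
elim: {s}(size s).+1 x y {-2}s (ltnSn (size s)) => // m IH x y s sm Xx Xs.
set S := chain_sum x (y :: s).
have S0 : 0 <= S / 2 by rewrite divr_ge0// chain_sum_ge0.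
have [s1 [z [s2 [E le1 or2]]]] := chain_split x y s S0.
have SE : S = chain_sum x s1 + (A (last x s1) z + chain_sum z s2).
  by rewrite /S E chain_sum_cat.
have [Xs1 [Xz Xs2]] : chain_in s1 /\ X z /\ chain_in s2.
  by move: Xs; rewrite E => /chain_in_cat.
have Xp : X (last x s1) by exact: chain_in_last.
have c1 := chain_sum_ge0 x s1; have c2 := chain_sum_ge0 z s2.
have pz : A (last x s1) z <= S by lra.
have lastE : last y s = last z s2.
  by rewrite -[LHS]/(last x (y :: s)) E last_cat.
have size_s : ((size s).+1 = size s1 + (size s2).+1)%N.
  by rewrite -[LHS]/(size (y :: s)) E size_cat.
have le2 : chain_sum z s2 <= S / 2.
  by case: or2 => [->|lt2] /=; [lra|rewrite SE in lt2 *; lra].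
have tail : forall t s', s2 = t :: s' -> A z (last z s2) <= S.
  move=> t s' s2E; have : A z (last t s') <= 2 * chain_sum z (t :: s').
    apply: IH => //; last by rewrite -s2E.
    by move: size_s sm; rewrite s2E /= => H; rewrite !ltnS; lia.
  by rewrite -s2E s2E /= -/(chain_sum z (t :: s')) -s2E; lra.
have head_ : forall t s', s1 = t :: s' -> A x (last x s1) <= S.
  move=> t s' s1E; have : A x (last t s') <= 2 * chain_sum x (t :: s').
    apply: IH => //; last by rewrite -s1E.
    by move: size_s sm; rewrite s1E /= => H; rewrite !ltnS; lia.
  by rewrite s1E /= -/(chain_sum x (t :: s')) -s1E; lra.
rewrite lastE.
have Xl : X (last z s2) by exact: chain_in_last.
(* An empty end piece is dropped and [A2] takes the place of [A3], since [A x x] need not be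
   small. *)
case E1 : s1 => [|t1 s1'] in head_ pz Xp *; case E2 : s2 => [|t2 s2'] in tail Xl *.
- by rewrite /= in pz *; lra.
- by apply: (A2 Xx Xz Xl pz); exact: tail.
- by apply: (A2 Xx Xp Xz _ pz); exact: head_.
- by apply: (A3 Xx Xp Xz Xl _ pz); [exact: head_|exact: tail].
Qed.

(** The empty chain is allowed, so the distance of a point to itself is 0 even though [A x x] may be
    positive. *)
Definition chain_dist x y : R :=
  inf [set chain_sum x s | s in [set s | chain_in s /\ last x s = y]].

Let has_inf_dist x y : X y ->
  has_inf [set chain_sum x s | s in [set s | chain_in s /\ last x s = y]].
Proof.
move=> Xy; split; first by exists (chain_sum x [:: y]), [:: y].
by exists 0 => _ [s _ <-]; exact: chain_sum_ge0.
Qed.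

Lemma chain_dist_step x y z : X y -> X z ->
  chain_dist x z <= chain_dist x y + A y z.
Proof.
move=> Xy Xz; rewrite -lerBlDr; apply: lb_le_inf; first by case: (has_inf_dist x Xy).
move=> _ [s [Xs sy] <-]; rewrite lerBlDr.
apply: ge_inf; first by case: (has_inf_dist x Xz).
exists (s ++ [:: z]); last by rewrite chain_sum_cat /= sy addr0.
by split; [apply/chain_in_cat|rewrite last_cat].
Qed.

Lemma chain_dist_refl x : X x -> chain_dist x x <= 0.
Proof. by move=> Xx; apply: ge_inf; [case: (has_inf_dist x Xx)|exists [::]]. Qed.

Lemma chain_dist_ge x y : X x -> X y -> x <> y -> A x y / 2 <= chain_dist x y.
Proof.
move=> Xx Xy xy; apply: lb_le_inf; first by case: (has_inf_dist x Xy).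
move=> _ [[|z s] [Xs sy] <-] //.
by rewrite ler_pdivrMr// mulrC -sy; exact: (frink Xx Xs).
Qed.

End frink.

(** * Gromov products and the visual quasi-metric *)

Section gromov_hyperbolic_space.
Context {R : realType} {T : Type} (X : set T) (k : T -> T -> R) (delta : R).
Hypotheses (k0 : forall x y, 0 <= k x y) (kC : forall x y, X x -> X y -> k x y = k y x)
  (kxx : forall x, X x -> k x x = 0)
  (hyp : forall x y z o, X x -> X y -> X z -> X o ->
    gromov_product k o x y >=
    Num.min (gromov_product k o x z) (gromov_product k o z y) - delta).
Implicit Types x y z w p o : T.

(** The four-point condition for the coincident pair [z], [z], the point [x] and the base [y] is
    already a triangle inequality up to [2 * delta]. *)
Lemma hyperbolic_triangle x y z : X x -> X y -> X z ->
  k x y <= k x z + k z y + 2 * delta.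
Proof.
move=> Xx Xy Xz; have := hyp Xz Xz Xx Xy.
by rewrite /gromov_product (kC Xz Xx) kxx// (addrC (k x y)) minxx; lra.
Qed.

Section visual.
Variables (o : T) (eps : R).
Hypotheses (Xo : X o) (eps0 : 0 <= eps) (eps_delta : expR (2 * eps * delta) <= 2)
  (delta0 : 0 <= delta).

Definition visual x y : R := expR (- eps * gromov_product k o x y).

Lemma visual_ge0 x y : 0 <= visual x y.
Proof. exact: expR_ge0. Qed.

Lemma visual_le r x y : r <= gromov_product k o x y -> visual x y <= expR (- eps * r).
Proof. by move=> rk; rewrite ler_expR !mulNr lerN2 ler_wpM2l. Qed.

Lemma gromov_product2 x y z r : X x -> X y -> X z ->
  r <= gromov_product k o x y -> r <= gromov_product k o y z ->
  r - delta <= gromov_product k o x z.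
Proof.
move=> Xx Xy Xz r1 r2; apply: le_trans (hyp Xx Xz Xy Xo).
by rewrite lerB// le_min r1.
Qed.

Lemma gromov_product3 x y z w r : X x -> X y -> X z -> X w ->
  r <= gromov_product k o x y -> r <= gromov_product k o y z ->
  r <= gromov_product k o z w -> r - 2 * delta <= gromov_product k o x w.
Proof.
move=> Xx Xy Xz Xw r1 r2 r3.
have := @gromov_product2 x z w (r - delta) Xx Xz Xw (gromov_product2 Xx Xy Xz r1 r2).
rewrite (_ : r - delta - delta = r - 2 * delta); last by ring.
by apply; apply: le_trans r3; rewrite gerBl.
Qed.

(** Each use of hyperbolicity loses [delta], hence a factor [expR (eps * delta)]. The bound on [eps]
    is calibrated so that the two losses of [visual_quasi3] stay within the factor 2 of Frink's
    lemma. *)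
Lemma visual_quasi2 x y z c : X x -> X y -> X z ->
  visual x y <= c -> visual y z <= c -> visual x z <= 2 * c.
Proof.
move=> Xx Xy Xz xy yz.
pose r := Num.min (gromov_product k o x y) (gromov_product k o y z).
have rc : expR (- eps * r) <= c.
  by rewrite /r; have [_|_] := leP (gromov_product k o x y) (gromov_product k o y z).
have : visual x z <= expR (- eps * (r - delta)).
  by apply: visual_le; apply: (gromov_product2 Xx Xy Xz); rewrite ge_min lexx ?orbT.
move/le_trans; apply.
rewrite (_ : - eps * (r - delta) = eps * delta + - eps * r); last by ring.
rewrite expRD; apply: ler_pM => //; try exact: expR_ge0.
apply: le_trans eps_delta; rewrite ler_expR.
have := mulr_ge0 eps0 delta0; lra.
Qed.

Lemma visual_quasi3 x y z w c : X x -> X y -> X z -> X w ->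
  visual x y <= c -> visual y z <= c -> visual z w <= c -> visual x w <= 2 * c.
Proof.
move=> Xx Xy Xz Xw xy yz zw.
pose r := Num.min (gromov_product k o x y)
  (Num.min (gromov_product k o y z) (gromov_product k o z w)).
have rc : expR (- eps * r) <= c.
  rewrite /r; have [//|_] := leP (gromov_product k o x y) _.
  by have [_|_] := leP (gromov_product k o y z) (gromov_product k o z w).
have : visual x w <= expR (- eps * (r - 2 * delta)).
  by apply: visual_le; apply: (gromov_product3 Xx Xy Xz Xw);
    rewrite !ge_min lexx ?orbT.
move/le_trans; apply.
rewrite (_ : - eps * (r - 2 * delta) = 2 * eps * delta + - eps * r); last by ring.
by rewrite expRD; apply: ler_pM => //; exact: expR_ge0.
Qed.

(* A point p on an almost geodesic from o to w, and a point p' nearby on an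
   almost geodesic from o to w'. *)
Lemma gromov_product_shadow p p' w w' : X p -> X p' -> X w -> X w' ->
  k o p + k p w <= k o w + 1 -> k o p' + k p' w' <= k o w' + 1 ->
  k p p' <= 1 -> k o p - (4 * delta + 2) <= gromov_product k o w w'.
Proof.
move=> Xp Xp' Xw Xw' pw pw' pp'; have delta_ge0 := delta0.
have H1 : k o p - 1 / 2 <= gromov_product k o w p.
  by rewrite /gromov_product (kC Xw Xo) (kC Xp Xo) (kC Xw Xp); lra.
have t1 := hyperbolic_triangle Xo Xp Xp'.
have t2 := kC Xp Xp'.
have H2 : k o p - 1 - delta <= gromov_product k o p p'.
  by rewrite /gromov_product (kC Xp Xo) (kC Xp' Xo); lra.
have H3 : k o p - 3 / 2 - 2 * delta <= gromov_product k o p' w'.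
  by rewrite /gromov_product (kC Xw' Xo) (kC Xp' Xo); lra.
have := @gromov_product3 w p p' w' (k o p - 3 / 2 - 2 * delta) Xw Xp Xp' Xw'.
by move=> H; have {}H := H ltac:(lra) ltac:(lra) H3; lra.
Qed.

(** Bounds the jump of the height between consecutive points of the discretized curve. *)
Lemma gromov_product_near w w' : X w -> X w' -> k w w' <= 1 ->
  k o w - 1 - delta <= gromov_product k o w w'.
Proof.
move=> Xw Xw' ww'; have t1 := hyperbolic_triangle Xo Xw Xw'.
by rewrite /gromov_product (kC Xw Xo) (kC Xw' Xo); have := kC Xw Xw'; lra.
Qed.

(* Along a curve from x to y with (x|y)_o <= 0, the function [chain_dist] of
   the visual quasi-metric passes, up to its jumps, through every t <= 1/2. *)
Lemma chain_dist_sample (n : nat) (w : nat -> T) (t : R) :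
  (forall i, (i <= n)%N -> X (w i)) -> w 0%N <> w n ->
  gromov_product k o (w 0%N) (w n) <= 0 -> 0 <= t -> t < 1 / 2 ->
  exists2 i, (i < n)%N & chain_dist X visual (w 0%N) (w i) <= t <=
    chain_dist X visual (w 0%N) (w i) + visual (w i) (w i.+1).
Proof.
move=> Xw w0n prod0 t0 t2; set f := chain_dist X visual (w 0%N).
have f0 : f (w 0%N) <= t.
  apply: le_trans t0; apply: chain_dist_refl (Xw 0%N _) => //.
  exact: visual_ge0.
(* The end points have visual distance at least 1, of which Frink's lemma keeps half. *)
have fn : 1 / 2 <= f (w n).
  have := chain_dist_ge visual_ge0 visual_quasi2 visual_quasi3 (Xw 0%N (leq0n n))
    (Xw n (leqnn n)) w0n.
  apply: le_trans; rewrite ler_pM2r ?invr_gt0// -expR0 ler_expR.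
  by rewrite mulNr -mulrN mulr_ge0// oppr_ge0.
have [i [ilt fi]] : exists i, (i < n)%N /\ (f (w i) <= t < f (w i.+1)).
  have : t < f (w n) by lra.
  elim: n {Xw w0n prod0 fn} => [|n IH]; first by rewrite ltNge f0.
  have [/IH[i [iltn H]] _|ge] := ltP t (f (w n)).
    by exists i; split => //; exact: ltnW.
  by move=> lt; exists n; rewrite ltnS leqnn ge.
exists i => //; case/andP: fi => -> /ltW /le_trans; apply.
apply: (chain_dist_step visual_ge0); apply: Xw => //; exact: ltnW.
Qed.

End visual.
End gromov_hyperbolic_space.

(** * Counting the visits of chains to cells *)

Lemma card_ord_near (N r : nat) (A : {set 'I_N}) (l : nat) :
  (forall l' : 'I_N, l' \in A -> (l <= l' + r)%N && (l' <= l + r)%N) ->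
  (#|A| <= r.*2.+1)%N.
Proof.
move=> H; rewrite cardE -(size_map val) -[leqRHS](size_iota (l - r)).
apply: uniq_leq_size.
  by rewrite map_inj_uniq ?enum_uniq//; exact: val_inj.
move=> _ /mapP[l' /[!mem_enum] l'A ->]; rewrite mem_iota.
by have /andP[h1 h2] := H _ l'A; rewrite leq_subLR addnC h1/=; lia.
Qed.

Lemma sum_geometric_le {R : realType} (q : R) (K : nat) : 0 <= q -> q < 1 ->
  \sum_(j < K) q ^+ j <= (1 - q)^-1.
Proof.
move=> q0 q1; have q1' : 0 < 1 - q by rewrite subr_gt0.
rewrite -(@ler_pM2l _ (1 - q))// divff ?gt_eqF//.
have -> : (1 - q) * (\sum_(j < K) q ^+ j) = 1 - q ^+ K.
  elim: K => [|K IH]; first by rewrite big_ord0 mulr0 expr0 subrr.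
  by rewrite big_ord_recr/= mulrDr IH exprS; ring.
by rewrite gerBl exprn_ge0.
Qed.

(* Cells are labelled by (ann, lev, cell); lev is the dyadic level of a cell. *)
Section cell_counting.
Local Open Scope set_scope.
Context {R : realType} (n : nat) (N K m : nat).
Let P := ('I_N * 'I_K)%type.
Variables (V : pred P) (ann : P -> 'I_m) (lev : P -> nat) (cell : P -> {ffun 'I_n -> nat}).
Variables (B M : nat) (e : P -> R) (E C q : R).
Hypotheses (n0 : (0 < n)%N) (N0 : (0 < N)%N) (B0 : (0 < B)%N) (E0 : 0 <= E)
  (C0 : 0 <= C) (q0 : 0 <= q) (q1 : q < 1) (e0 : forall p, 0 <= e p).

(** An index [(l, j)] is step [j] of chain [l], and [V] marks the steps that lie in one of the
    annuli. [(1 / 2) ^+ lev p] stands for the relative diameter of the cell, and [e p] for the n-th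
    root of the visual size of its shadow. *)
Definition same_cell (p p' : P) :=
  [&& V p', ann p == ann p', lev p == lev p' & cell p == cell p'].

Hypothesis cell_lt : forall p i, V p -> (cell p i < B * 2 ^ lev p)%N.
Hypothesis crossing : forall l i,
  1 <= \sum_(j < K | V (l, j) && (ann (l, j) == i)) (1 / 2) ^+ lev (l, j) :> R.
Hypothesis shadow : forall p p', V p -> same_cell p p' ->
  `|(p'.1 : nat)%:R - (p.1 : nat)%:R| <= N%:R * E * e p ^+ n.
Hypothesis shadow_ge1 : forall p, V p -> 1 <= N%:R * E * e p ^+ n.
Hypothesis multiplicity : forall p p', V p -> same_cell p p' -> p.1 = p'.1 ->
  (p'.2 <= p.2 + M)%N.
Hypothesis decay : forall l j, V (l, j) -> e (l, j) <= C * q ^+ j.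

Let nu p := #|[set p' | same_cell p p']|.

Lemma same_cell_trans p p1 p2 : same_cell p p1 -> same_cell p p2 -> same_cell p1 p2.
Proof.
rewrite /same_cell => /and4P[_ /eqP -> /eqP -> /eqP ->].
by move=> /and4P[-> /eqP -> /eqP -> /eqP ->]; rewrite !eqxx.
Qed.

(** [shadow] confines the chain index to an interval of radius [X], which holds at most [3 * X]
    integers because [X >= 1]; [multiplicity] bounds the steps within each chain. *)
Lemma card_same_cell p : V p ->
  (nu p)%:R <= N%:R * (3 * E * M.*2.+1%:R) * e p ^+ n.
Proof.
move=> Vp; set X := N%:R * E * e p ^+ n.
have X1 : 1 <= X by exact: shadow_ge1.
have X0 : 0 <= X by lra.
pose r := Num.truncn X.
have rX : r%:R <= X by rewrite /r truncn_le.
have near_nat (a b : nat) : `|a%:R - b%:R| <= X -> (b <= a + r)%N && (a <= b + r)%N.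
  move=> abX; have [ab|/ltnW ba] := leqP a b.
    rewrite (leq_trans ab) ?leq_addr// andbT -leq_subLR truncn_ge_nat// natrB//.
    by apply: le_trans abX; rewrite distrC ler_norm.
  rewrite (leq_trans ba) ?leq_addr//= -leq_subLR truncn_ge_nat// natrB//.
  by apply: le_trans abX; rewrite ler_norm.
pose A := [set l | [exists j, same_cell p (l, j)]].
have cA : (#|A| <= r.*2.+1)%N.
  apply: (@card_ord_near N r A p.1) => l'; rewrite inE => /existsP[j' pp'].
  exact: near_nat (shadow Vp pp').
have cF l : (#|[set j | same_cell p (l, j)]| <= M.*2.+1)%N.
  have [->|[j0]] := set_0Vmem [set j | same_cell p (l, j)]; first by rewrite cards0.
  rewrite inE => pj0; apply: (@card_ord_near K M _ j0) => j; rewrite inE => pj.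
  have Vj : V (l, j) by case/and4P: pj.
  have Vj0 : V (l, j0) by case/and4P: pj0.
  by rewrite (multiplicity Vj (same_cell_trans pj pj0))//=
    (multiplicity Vj0 (same_cell_trans pj0 pj)).
have nuE : nu p = (\sum_(l < N) #|[set j | same_cell p (l, j)]|)%N.
  rewrite /nu -sum1_card (eq_bigl (fun p' => same_cell p p')); last first.
    by move=> p'; rewrite inE.
  under [RHS]eq_bigr do rewrite -sum1_card.
  rewrite pair_big_dep/=; apply: eq_bigl => -[l j] /=.
  by rewrite inE.
have nuA : (nu p <= #|A| * M.*2.+1)%N.
  rewrite nuE (bigID (mem A))/= [X in (_ + X)%N]big1 ?addn0; last first.
    move=> l; rewrite inE => /existsPn lA; apply/eqP; rewrite cards_eq0.
    by apply/eqP/setP => j; rewrite !inE; apply/negbTE.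
  by rewrite -sum_nat_const; apply: leq_sum => l _; exact: cF.
have r3 : (r.*2.+1)%:R <= 3 * X :> R.
  by rewrite -addnn -addn1 !natrD; lra.
apply: (@le_trans _ _ ((r.*2.+1)%:R * (M.*2.+1)%:R)).
  by rewrite -natrM ler_nat (leq_trans nuA)// leq_mul2r cA orbT.
apply: (@le_trans _ _ (3 * X * (M.*2.+1)%:R)); first by rewrite ler_wpM2r.
by rewrite le_eqVlt; apply/orP; left; apply/eqP; rewrite /X; ring.
Qed.

Let w p : R := (1 / 2) ^+ lev p.
(** With this value the bad cells of level [s] in one annulus carry weight at most
    [(1 / 2) ^+ s * N / 4], in total [N / 2]: half of what [crossing] provides. *)
Let lam : R := (4 * B%:R ^+ n)^-1.
Let bad p := (nu p)%:R <= lam * N%:R * w p ^+ n.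

(** There are at most [(B * 2 ^ s) ^ n] cells, each with at most [lam * N / 2 ^ (s * n)] visits if
    bad; the powers of [2 ^ s] cancel. *)
Lemma card_bad_level (i : 'I_m) (s : nat) :
  #|[set p | [&& V p, bad p, ann p == i & lev p == s]]|%:R
  <= B%:R ^+ n * lam * N%:R :> R.
Proof.
set A := [set p | _]; pose Y := (B * 2 ^ s)%N.
have Y0 : (0 < Y)%N by rewrite muln_gt0 B0 expn_gt0.
(* Cells become elements of a finite type; [cell_lt] ensures that [inord] loses nothing on the
   indices in [A]. *)
pose f p : {ffun 'I_n -> 'I_Y.-1.+1} := [ffun k => inord (cell p k)].
pose b : R := lam * N%:R * ((1 / 2) ^+ s) ^+ n.
have b0 : 0 <= b.
  by rewrite !mulr_ge0 ?exprn_ge0 ?invr_ge0 ?mulr_ge0 ?exprn_ge0.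
have fib c : #|[set p in A | f p == c]|%:R <= b.
  have [->|[p0]] := set_0Vmem [set p in A | f p == c]; first by rewrite cards0.
  rewrite !inE => /andP[/and4P[V0 bad0 /eqP a0 /eqP l0] /eqP f0].
  apply: (@le_trans _ _ (nu p0)%:R); last by rewrite /b -l0.
  rewrite ler_nat; apply/subset_leq_card/fintype.subsetP => p.
  rewrite !inE => /andP[/and4P[Vp _ /eqP ap /eqP lp] /eqP fp].
  rewrite /same_cell Vp a0 ap l0 lp !eqxx/=; apply/eqP/ffunP => k.
  have : f p0 k = f p k by rewrite f0 fp.
  rewrite !ffunE => /(congr1 val)/=.
  by rewrite !inordK// prednK// /Y -?l0 ?cell_lt// l0 -lp cell_lt.
have -> : #|A| = (\sum_(c : {ffun 'I_n -> 'I_Y.-1.+1}) #|[set p in A | f p == c]|)%N.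
  rewrite -sum1_card (partition_big f xpredT)//=; apply: eq_bigr => c _.
  by rewrite -sum1_card; apply: eq_bigl => p; rewrite !inE.
rewrite natr_sum; apply: (@le_trans _ _ (\sum_(c : {ffun 'I_n -> 'I_Y.-1.+1}) b)).
  by apply: ler_sum => c _; exact: fib.
rewrite sumr_const card_ffun !card_ord prednK// -[leLHS]mulr_natl le_eqVlt.
apply/orP; left; apply/eqP; rewrite /b /Y natrX natrM natrX exprMn.
have -> : (1 / 2 : R) ^+ s ^+ n = (2 ^+ s ^+ n)^-1.
  by rewrite div1r !exprVn.
by field; rewrite !expf_neq0.
Qed.

Lemma bad_sum : \sum_(p | V p && bad p) w p <= (m * N)%:R / 2.
Proof.
pose S := (\max_p lev p).+1.
have levS p : (lev p < S)%N by rewrite ltnS; apply: leq_bigmax.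
rewrite (partition_big ann xpredT)//=.
apply: (@le_trans _ _ (\sum_(i < m) N%:R / 2)); last first.
  by rewrite sumr_const card_ord -[leLHS]mulr_natl natrM mulrA.
apply: ler_sum => i _.
rewrite (partition_big (fun p => Ordinal (levS p)) xpredT)//=.
apply: (@le_trans _ _ (\sum_(s < S) (1 / 2) ^+ s * (N%:R / 4))).
  apply: ler_sum => s _.
  rewrite (eq_bigr (fun=> (1 / 2) ^+ s)); last first.
    by move=> p /andP[_ /eqP <-].
  rewrite sumr_const -[leLHS]mulr_natl mulrC ler_wpM2l ?exprn_ge0//.
  have := card_bad_level i s.
  have -> : B%:R ^+ n * lam * N%:R = N%:R / 4.
    by rewrite /lam; field; rewrite expf_neq0// pnatr_eq0 -lt0n.
  apply: le_trans; rewrite ler_nat.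
  apply/subset_leq_card/fintype.subsetP => p Hp; rewrite inE.
  by move: Hp => /andP[/andP[/andP[-> ->] ->]] /eqP <-; rewrite eqxx.
rewrite -mulr_suml.
apply: (@le_trans _ _ (2 * (N%:R / 4))); last by rewrite le_eqVlt; apply/orP; left; apply/eqP; field.
rewrite ler_wpM2r ?divr_ge0//.
have half : (1 - 1 / 2 : R)^-1 = 2 by field.
by have := @sum_geometric_le R (1 / 2) S; rewrite half; apply; lra.
Qed.

Lemma good_weight p : V p -> ~~ bad p ->
  w p <= (1 + 12 * E * M.*2.+1%:R * B%:R ^+ n) * e p.
Proof.
move=> Vp; rewrite /bad -ltNge => good.
(* The summand 1 gives [F <= F ^+ n], so the n-th root of the constant need not be taken; 12 is the
   4 of [lam] times the 3 of [card_same_cell]. *)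
set F := 1 + _.
have X0 : 0 <= 12 * E * M.*2.+1%:R * B%:R ^+ n by rewrite !mulr_ge0 ?exprn_ge0.
have F1 : 1 <= F by rewrite lerDl.
have B0' : 0 < B%:R ^+ n :> R by rewrite exprn_gt0// ltr0n.
have wE : w p ^+ n <= 12 * E * M.*2.+1%:R * B%:R ^+ n * e p ^+ n.
  have := lt_le_trans good (card_same_cell Vp).
  have -> : lam * N%:R * w p ^+ n = N%:R / (4 * B%:R ^+ n) * w p ^+ n.
    by rewrite /lam; ring.
  have N0' : 0 < N%:R :> R by rewrite ltr0n.
  have c0 : 0 < N%:R / (4 * B%:R ^+ n) :> R by rewrite divr_gt0// mulr_gt0.
  move/ltW; rewrite -ler_pdivlMl// => /le_trans; apply.
  rewrite le_eqVlt; apply/orP; left; apply/eqP; field.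
  by rewrite !gt_eqF.
rewrite -(@ler_pXn2r _ n)// ?nnegrE ?mulr_ge0 ?exprn_ge0//; last by lra.
rewrite exprMn; apply: (le_trans wE); rewrite ler_wpM2r ?exprn_ge0//.
apply: (@le_trans _ _ F); first by rewrite /F lerDr.
by case: (n) n0 => // n' _; rewrite ler_eXnr.
Qed.

Lemma good_sum : \sum_(p | V p && ~~ bad p) w p <=
  N%:R * ((1 + 12 * E * M.*2.+1%:R * B%:R ^+ n) * C / (1 - q)).
Proof.
set F := 1 + _.
have F0 : 0 <= F by rewrite addr_ge0// !mulr_ge0 ?exprn_ge0.
have q1' : 0 < 1 - q by rewrite subr_gt0.
apply: (@le_trans _ _ (\sum_(p : P) F * (C * q ^+ p.2))).
  rewrite [leRHS](bigID (fun p => V p && ~~ bad p))/= ler_wpDr//.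
    by apply: sumr_ge0 => p _; rewrite !mulr_ge0 ?exprn_ge0.
  apply: ler_sum => -[l j] /andP[Vp gp]; apply: (le_trans (good_weight Vp gp)).
  by rewrite ler_wpM2l//; exact: decay.
rewrite -(pair_big xpredT xpredT (fun (l : 'I_N) (j : 'I_K) => F * (C * q ^+ j)))/=.
rewrite sumr_const card_ord -[leLHS]mulr_natl ler_wpM2l//.
rewrite -mulr_sumr -mulr_sumr -!mulrA ler_wpM2l// ler_wpM2l//.
exact: sum_geometric_le.
Qed.

(** Summed over chains and annuli, [crossing] gives weight at least [m * N]. Bad cells carry at most
    half, so the good ones carry the rest, which is bounded by [N] times a constant. *)
Lemma cell_counting :
  m%:R <= 2 * ((1 + 12 * E * M.*2.+1%:R * B%:R ^+ n) * C / (1 - q)).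
Proof.
have N0' : 0 < N%:R :> R by rewrite ltr0n.
rewrite -(@ler_pM2l _ N%:R)//.
have H : (m * N)%:R <= \sum_(p | V p) w p.
  apply: (@le_trans _ _ (\sum_(l < N) \sum_(i < m) 1)).
    by rewrite !sumr_const !card_ord -mulrnA.
  apply: (@le_trans _ _ (\sum_(l < N) \sum_(j < K | V (l, j)) w (l, j))).
    apply: ler_sum => l _; rewrite (partition_big (fun j => ann (l, j)) xpredT)//=.
    by apply: ler_sum => i _; exact: crossing.
  by rewrite pair_big_dep/= le_eqVlt; apply/orP; left; apply/eqP;
    apply: eq_big => -[].
have := H; rewrite (bigID bad)/= natrM => H2.
have := bad_sum; have := good_sum; rewrite natrM; lra.
Qed.

End cell_counting.

(** * Dyadic levels, and the cost of crossing an annulus *)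

Lemma powers_bracket {R : realType} (b u : R) : 1 < b -> 1 <= u ->
  exists i, b ^+ i <= u < b ^+ i.+1.
Proof.
move=> b1 u1; have b0 : 0 <= b - 1 by lra.
have bern i : 1 + i%:R * (b - 1) <= b ^+ i.
  elim: i => [|i IH]; first by rewrite mul0r addr0 expr0.
  rewrite exprS -natr1; have i0 : 0 <= i%:R :> R by [].
  have := ler_wpM2l (_ : 0 <= b) IH => /(_ (ltac:(lra))).
  have := mulr_ge0 (mulr_ge0 i0 b0) b0; lra.
have [K uK] : exists K, u < b ^+ K.
  exists (Num.truncn (u / (b - 1))).+1; apply: lt_le_trans (bern _).
  have := truncnS_gt (u / (b - 1)); rewrite ltr_pdivrMr ?subr_gt0//; lra.
elim: K uK => [|K IH]; first by rewrite expr0 ltNge u1.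
by have [/IH//|Ku uK] := ltP u (b ^+ K); exists K; rewrite Ku uK.
Qed.

(** [phi] clamps [u] to the inner range from [r] to [2 * r] and drops by [r] in total. Steps from
    below [r] cannot lower it; a step from [4 * r] or beyond has length at most [u / 4], so it ends
    above [2 * r] where [phi] is constant. Only the steps counted on the right pay. *)
Lemma crossing_sum {R : realType} (N : nat) (u dd : nat -> R) (r : R) : 0 < r ->
  2 * r <= u 0%N -> u N <= r ->
  (forall j, (j < N)%N -> `|u j.+1 - u j| <= dd j / 8) ->
  (forall j, (j <= N)%N -> 0 <= dd j) ->
  (forall j, (j <= N)%N -> r <= u j -> dd j <= 2 * u j) ->
  r <= \sum_(j < N.+1 | (r <= u j) && (u j < 4 * r)) dd j / 8.
Proof.
move=> r0 u0 uN stp dd0 ddu; pose phi v : R := Num.min (Num.max v r) (2 * r).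
have phi_le v v' : v' <= v -> 0 <= phi v - phi v' <= v - v'.
  have phiE t : phi t = if t <= r then r else if t <= 2 * r then t else 2 * r.
    rewrite /phi; have [tr|rt] := leP t r; first by rewrite min_l//; lra.
    by have [] := leP t (2 * r).
  move=> vv'; rewrite !phiE; apply/andP.
  by case: (leP v r); case: (leP v' r); case: (leP v (2 * r));
    case: (leP v' (2 * r)); split; lra.
have E : \sum_(j < N) (phi (u j) - phi (u j.+1)) = r.
  rewrite -(big_mkord xpredT (fun j => phi (u j) - phi (u j.+1))).
  rewrite (eq_bigr (fun j => - (phi (u j.+1) - phi (u j)))); last first.
    by move=> j _; rewrite opprB.
  rewrite sumrN telescope_sumr// /phi.
  rewrite (max_r uN) (min_l (_ : r <= 2 * r)); last by lra.
  by rewrite (max_l (_ : r <= u 0%N)) ?(min_r u0)//; lra.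
rewrite -[leLHS]E [leRHS]big_mkcond/= big_ord_recr/= ler_wpDr//.
  by case: ifP => // _; rewrite divr_ge0// dd0.
apply: ler_sum => j _.
have jN := ltn_ord j; have := stp j jN; rewrite ler_norml => /andP[s1 s2].
have dj := dd0 j (ltnW jN); have uj := ddu j (ltnW jN).
have [ruj|ujr] := leP r (u j) => /=; last first.
  have [le1|lt1] := leP (u j) (u j.+1).
    by have /andP[] := phi_le _ _ le1; lra.
  have -> : phi (u j) = phi (u j.+1) by rewrite /phi !max_r//; lra.
  by rewrite subrr.
have {}uj := uj ruj.
have [le1|lt1] := leP (u j) (u j.+1).
  by have /andP[H _] := phi_le _ _ le1; case: ifP => _; lra.
have /andP[_ H] := phi_le _ _ (ltW lt1).
case: ltP => u4; first by lra.
rewrite /phi !max_l; try lra.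
by rewrite !min_r; lra.
Qed.

(** * The estimate in a hyperbolic domain *)

Section main_estimate.
Context {R : realType} {n : nat} (G : set 'rV[R]_n) (delta : R).
Hypotheses (n0 : (0 < n)%N) (delta0 : 0 <= delta).
Hypotheses (Gdom : is_domain G) (GT : G <> setT).
Hypothesis (hyp : gromov_hyperbolic G delta).
Local Notation d := (bdist G).
Local Notation k := (qh_dist G).
Implicit Types x y z w p : 'rV[R]_n.

Let kC x y : G x -> G y -> k x y = k y x.
Proof. exact: qh_distC. Qed.

Let k0 x y : 0 <= k x y.
Proof. exact: qh_dist_ge0. Qed.

Lemma qh_distxx x : G x -> k x x = 0.
Proof.
move=> Gx; apply/eqP; rewrite eq_le k0 andbT.
have := @qh_dist_near_le _ _ _ Gdom GT x x Gx.
rewrite subrr enorm0 mulr0 mul0r; apply.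
by rewrite divr_ge0// ltW// (bdist_gt0 Gdom GT).
Qed.

Let tri x y z : G x -> G y -> G z -> k x y <= k x z + k z y + 2 * delta.
Proof. exact: (hyperbolic_triangle kC qh_distxx hyp). Qed.

Lemma qh_dist_le1 x y : G x -> enorm (x - y) <= d x / 2 -> k x y <= 1.
Proof.
move=> Gx xy; have dx := bdist_gt0 Gdom GT Gx.
apply: le_trans (qh_dist_near_le Gdom GT Gx xy) _.
by rewrite ler_pdivrMr//; lra.
Qed.

(** Discretizes a curve that may have infinite length: nearby points are [k]-close by continuity,
    and chains over adjacent intervals concatenate, as Cousin's lemma requires. *)
Lemma curve_chain (a b : R) (g : R -> 'rV[R]_n) x y : curve_in G x y a b g ->
  exists (m : nat) (w : nat -> 'rV[R]_n), [/\ w 0%N = x, w m = y,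
    forall i, (i <= m)%N -> (g @` `[a, b]) (w i)
    & forall i, (i < m)%N -> k (w i) (w i.+1) <= 1].
Proof.
move=> [ab /within_continuous_enormP cg gG <- <-].
pose Q s t := exists (m : nat) (w : nat -> 'rV[R]_n), [/\ w 0%N = g s, w m = g t,
    forall i, (i <= m)%N -> (g @` `[a, b]) (w i)
    & forall i, (i < m)%N -> k (w i) (w i.+1) <= 1].
suff : Q a b by [].
apply: (@cousin R Q a b ab).
  move=> r s t _ _ _ _ [m1 [w1 [w10 w1m w1g w1k]]] [m2 [w2 [w20 w2m w2g w2k]]].
  exists (m1 + m2)%N, (fun i => if (i <= m1)%N then w1 i else w2 (i - m1)%N); split.
  - by rewrite leq0n.
  - have [m20|m20] := eqVneq m2 0%N.
      by rewrite m20 addn0 leqnn w1m -w20 -w2m m20.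
    by rewrite -[X in (_ <= X)%N]addn0 leq_add2l leqn0 (negbTE m20) addKn.
  - move=> i im; case: ifP => [|im1]; first exact: w1g.
    by apply: w2g; rewrite leq_subLR.
  - move=> i im; have [im1|im1] := leqP i.+1 m1.
      by rewrite (ltnW im1); exact: w1k.
    case: ifP => im1'.
      have -> : i = m1 by lia.
      rewrite subSnn w1m -w20; apply: w2k; lia.
    by rewrite subSn; [apply: w2k; lia|lia].
move=> t tab; have Gt : G (g t) by apply: gG; exists t.
have dt := bdist_gt0 Gdom GT Gt.
have [|h h0 hP] := cg t tab (d (g t) / 16); first by rewrite divr_gt0.
exists h => // r s ar rs sb tr ts.
have rab : r \in `[a, b] by rewrite in_itv/= ar (le_trans rs).
have sab : s \in `[a, b] by rewrite in_itv/= sb (le_trans ar).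
exists 1%N, (fun i => if i == 0%N then g r else g s); split => //.
  by move=> i _; case: ifP => _; [exists r|exists s].
move=> i; rewrite ltnS leqn0 => /eqP -> /=.
have Gr : G (g r) by apply: gG; exists r.
apply: qh_dist_le1 => //.
have := hP r rab tr; have := hP s sab ts.
have := bdist_lip Gdom GT (g t) Gr; have := ler_enorm_dist (g t) (g r) (g s).
rewrite (enorm_distC (g r) (g t)); lra.
Qed.

(** The [+ 1] keeps the quotient defined and positive when [delta = 0]. *)
Definition visual_eps : R := ln 2 / (2 * delta + 1).

Lemma visual_eps_gt0 : 0 < visual_eps.
Proof. by rewrite divr_gt0// ?ln_gt0 ?ltr1n//; have := delta0; lra. Qed.

Lemma visual_eps_deltaP : expR (2 * visual_eps * delta) <= 2.
Proof.
have H := delta0; have l2 : 0 <= ln 2 :> R by rewrite ln_ge0// ler1n.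
rewrite -[leRHS]lnK ?posrE// ler_expR /visual_eps.
rewrite (_ : _ * _ = ln 2 * ((2 * delta) / (2 * delta + 1))); last by field; lra.
rewrite ler_piMr// ler_pdivrMr; lra.
Qed.

(** The 4 is the spacing [1 / (2 * N)] of the heights times two error terms: a visual distance and a
    sampling jump. The exponent covers the losses in both. *)
Definition shadow_cst : R := 4 * expR (visual_eps * (4 * delta + 3)).
(** Between two visits of one chain to a cell, [al] grows by at most [4 * delta + 2], and every step
    adds 1/9. *)
Definition mult_cst : nat := (Num.truncn (36 * delta + 18)).+1.
(** From [j / 9 <= al l j <= k z (pt l j) + 1 + 2 * delta]; the next constant is the factor per
    step. *)
Definition decay_cst : R := expR (visual_eps * (2 * delta + 1) / n%:R).
Definition decay_rate : R := expR (- (visual_eps / 9 / n%:R)).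
Definition annuli_cst : R :=
  2 * ((1 + 12 * shadow_cst * mult_cst.*2.+1%:R * (8 * n)%:R ^+ n)
       * decay_cst / (1 - decay_rate)).

(** * Bounding the number of annuli between z and the curve *)

Section annuli.
Variables (x y z : 'rV[R]_n) (a b : R) (g : R -> 'rV[R]_n) (D : R) (m : nat).
Hypotheses (Gz : G z) (gxy : curve_in G x y a b g) (xy : x <> y)
  (xyz : gromov_product k z x y <= 0) (gD : forall t, t \in `[a, b] -> enorm (g t - x) <= D)
  (D0 : 0 < D) (dx : d x <= 4 * D) (zx : 4 ^+ m.+1 * (4 * D) <= enorm (z - x)).

Let Gx : G x.
Proof. by case: gxy => ab _ gG <- _; apply: gG; exists a; rewrite //= in_itv/= lexx. Qed.

Let f := chain_dist G (visual k z visual_eps) x.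

(* The sample point with index l sits at height l / (2 N) of [f]. *)
Lemma curve_samples : exists2 N : nat, (0 < N)%N & exists w : 'I_N -> 'rV[R]_n,
  [/\ forall l, G (w l), forall l, enorm (w l - x) <= D,
      forall l, f (w l) <= (l : nat)%:R / (2 * N%:R) <=
        f (w l) + expR (- visual_eps * (k z (w l) - 1 - delta))
    & forall l, expR (visual_eps * (k z (w l) + 1)) <= N%:R].
Proof.
have [m' [w [w0 wm wg wk]]] := curve_chain gxy.
have wG i : (i <= m')%N -> G (w i).
  by case: gxy => _ _ gG _ _ im; apply: gG; exact: wg.
pose Bd := \sum_(i < m'.+1) k z (w i).
have BdP i : (i <= m')%N -> k z (w i) <= Bd.
  move=> im; rewrite /Bd (bigD1 (Ordinal (im : (i < m'.+1)%N)))//= lerDl.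
  by apply: sumr_ge0.
(* [Bd] bounds [k z] on the whole discretized curve, so one [N] is large enough for every sample
   chosen later. *)
pose N := (Num.truncn (expR (visual_eps * (Bd + 1)))).+1.
exists N => //.
have H (l : 'I_N) : exists w', [/\ G w', enorm (w' - x) <= D,
      f w' <= (l : nat)%:R / (2 * N%:R) <= f w' + expR (- visual_eps * (k z w' - 1 - delta))
    & expR (visual_eps * (k z w' + 1)) <= N%:R].
  have w0m : w 0%N <> w m' by rewrite w0 wm.
  have prod0 : gromov_product k z (w 0%N) (w m') <= 0 by rewrite w0 wm.
  have t0 : 0 <= (l : nat)%:R / (2 * N%:R) :> R by rewrite divr_ge0.
  have t2 : (l : nat)%:R / (2 * N%:R) < 1 / 2 :> R.
    rewrite ltr_pdivrMr ?mulr_gt0 ?ltr0n// mulrA div1r mulVf// mul1r ltr_nat.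
    exact: ltn_ord.
  have [i im /andP[fi1 fi2]] := chain_dist_sample hyp Gz (ltW visual_eps_gt0)
    visual_eps_deltaP delta0 wG w0m prod0 t0 t2.
  rewrite w0 in fi1 fi2.
  exists (w i); split.
  - exact/wG/ltnW.
  - by have [t tab <-] := wg i (ltnW im); exact: gD.
  - rewrite fi1; apply: (le_trans fi2); rewrite lerD2l.
    apply: visual_le; first exact/ltW/visual_eps_gt0.
    apply: (gromov_product_near kC qh_distxx hyp Gz) => //; try exact: wG.
      exact/wG/ltnW.
    exact: wk.
  - apply: le_trans (ltW (truncnS_gt _)); rewrite ler_expR.
    by rewrite ler_wpM2l ?(ltW visual_eps_gt0)// lerD2r BdP// ltnW.
have [w' w'P] := choice H.
by exists w'; split => l; have [] := w'P l.
Qed.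

Lemma decay_rate_lt1 : decay_rate < 1.
Proof.
have ep := visual_eps_gt0; rewrite /decay_rate -[ltRHS]expR0 ltr_expR oppr_lt0.
by apply: divr_gt0; [apply: divr_gt0|rewrite ltr0n].
Qed.

(** * Whitney cells and verification of the counting hypotheses *)

Section counting.
Variables (N : nat) (w : 'I_N -> 'rV[R]_n) (L : 'I_N -> nat)
  (pt : 'I_N -> nat -> 'rV[R]_n) (al : 'I_N -> nat -> R).
Let K := (\max_l L l).+1.
Let P := ('I_N * 'I_K)%type.
Variables (ann : P -> 'I_m) (lev : P -> nat).
Hypotheses (N0 : (0 < N)%N) (wG : forall l, G (w l)) (wD : forall l, enorm (w l - x) <= D)
  (wf : forall l, f (w l) <= (l : nat)%:R / (2 * N%:R) <=
        f (w l) + expR (- visual_eps * (k z (w l) - 1 - delta)))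
  (wN : forall l, expR (visual_eps * (k z (w l) + 1)) <= N%:R).
Hypotheses (pt0 : forall l, pt l 0%N = z)
  (ptG : forall l j, (j <= L l)%N -> G (pt l j))
  (pt_al : forall l j, (j <= L l)%N -> k z (pt l j) <= al l j)
  (ptw : forall l j, (j <= L l)%N -> k (pt l j) (w l) <= k z (w l) + 1 - al l j)
  (ptS : forall l j, (j < L l)%N -> enorm (pt l j.+1 - pt l j) <= d (pt l j) / 8)
  (al0 : forall l, 0 <= al l 0%N)
  (alS : forall l j, (j < L l)%N -> al l j + 1 / 9 <= al l j.+1)
  (ptL : forall l, enorm (w l - pt l (L l)) <= d (pt l (L l)) / 8).

Let rad (i : nat) : R := 4 ^+ i * (4 * D).
Let pP (q : P) := pt q.1 q.2.
Let V (q : P) := (q.2 <= L q.1)%N &&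
  [exists i : 'I_m, rad i <= enorm (pP q - x) < 4 * rad i].

Hypothesis (annP : forall q, V q ->
  rad (ann q) <= enorm (pP q - x) < 4 * rad (ann q)).
Hypothesis (levP : forall q, V q ->
  2 ^+ lev q <= 8 * rad (ann q) / d (pP q) < 2 ^+ (lev q).+1).

Let rad_gt0 i : 0 < rad i.
Proof. by rewrite mulr_gt0 ?exprn_gt0 ?mulr_gt0. Qed.

Let V_le q : V q -> (q.2 <= L q.1)%N.
Proof. by case/andP. Qed.

Let pG q : V q -> G (pP q).
Proof. by move=> /V_le; exact: ptG. Qed.

(** Coordinates are shifted by [4 * rad] to be nonnegative and cover a range of [8 * rad]. The mesh
    [rad / (n * 2 ^ lev)] gives [8 * n * 2 ^ lev] values per coordinate and cells of Euclidean
    diameter at most [d / 4], hence of [k]-diameter at most 1. *)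
Let cell (q : P) : {ffun 'I_n -> nat} := [ffun i => Num.truncn
  (((pP q - x) ord0 i + 4 * rad (ann q)) * (n%:R * 2 ^+ lev q / rad (ann q)))].

Let cell_scale_gt0 q : 0 < n%:R * 2 ^+ lev q / rad (ann q).
Proof. by rewrite divr_gt0// mulr_gt0 ?ltr0n// exprn_gt0. Qed.

Let cell_arg_ge0 q i : V q ->
  0 <= ((pP q - x) ord0 i + 4 * rad (ann q)) * (n%:R * 2 ^+ lev q / rad (ann q)).
Proof.
move=> /annP/andP[_ u4]; rewrite mulr_ge0 ?(ltW (cell_scale_gt0 q))//.
by have := enorm_coord (pP q - x) i; rewrite ler_norml => /andP[]; lra.
Qed.

Let cell_bound q i : V q -> (cell q i < 8 * n * 2 ^ lev q)%N.
Proof.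
move=> Vq; have /andP[_ u4] := annP Vq; rewrite ffunE truncn_lt_nat ?cell_arg_ge0//.
rewrite !natrM natrX.
have -> : 8%:R * n%:R * 2%:R ^+ lev q =
    8 * rad (ann q) * (n%:R * 2 ^+ lev q / rad (ann q)) :> R.
  by field; rewrite gt_eqF.
rewrite ltr_pM2r//.
by have := enorm_coord (pP q - x) i; rewrite ler_norml => /andP[]; lra.
Qed.

Let same_near q q' : V q -> same_cell V ann lev cell q q' -> k (pP q) (pP q') <= 1.
Proof.
move=> Vq /and4P[Vq' /eqP aE /eqP lE /eqP cE].
apply: qh_dist_le1; first exact: pG.
have dq := bdist_gt0 Gdom GT (pG Vq); have rq := rad_gt0 (ann q).
set s := n%:R * 2 ^+ lev q / rad (ann q).
have s0 : 0 < s by exact: cell_scale_gt0.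
have n0' : 0 < n%:R :> R by rewrite ltr0n.
have coord i : `|(pP q - pP q') ord0 i| <= s^-1.
  have := congr1 (fun c : {ffun 'I_n -> nat} => c i) cE; rewrite !ffunE => tE.
  have a0 := cell_arg_ge0 i Vq; have a0' := cell_arg_ge0 i Vq'.
  have := truncn_itv a0; have := truncn_itv a0'.
  rewrite -tE -aE -lE -/s; set t := Num.truncn _; rewrite -[t.+1%:R]natr1.
  move=> /andP[h1 h2] /andP[h3 h4].
  rewrite -(@ler_pM2r _ s)// mulVf ?gt_eqF// -{1}(gtr0_norm s0) -normrM.
  rewrite !mxE in h1 h2 h3 h4 *.
  by rewrite ler_norml; apply/andP; split; lra.
have : enorm (pP q - pP q') <= n%:R * s^-1.
  apply: le_trans (enorm_le_sum _) _.
  apply: (@le_trans _ _ (\sum_(i < n) s^-1)); first exact: ler_sum.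
  by rewrite sumr_const card_ord mulr_natl.
move/le_trans; apply.
have -> : n%:R * s^-1 = rad (ann q) / 2 ^+ lev q.
  by rewrite /s; field; rewrite !gt_eqF// exprn_gt0.
rewrite ler_pdivrMr ?exprn_gt0//.
have /andP[_] := levP Vq; rewrite ltr_pdivrMr// exprS; lra.
Qed.

Let al_mono l j i : (j + i <= L l)%N -> al l j + i%:R / 9 <= al l (j + i)%N.
Proof.
elim: i => [|i IH]; first by rewrite mul0r addr0 addn0.
rewrite addnS => ji; have := alS ji; have := IH (ltnW ji).
by rewrite -natr1; lra.
Qed.

Let al_le l j : (j <= L l)%N -> al l j <= k z (pt l j) + 1 + 2 * delta.
Proof.
by move=> jL; have := tri Gz (wG l) (ptG jL); have := ptw jL; lra.
Qed.

Let e (q : P) : R := expR (- (visual_eps * k z (pP q)) / n%:R).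

Let eX q : e q ^+ n = expR (- (visual_eps * k z (pP q))).
Proof.
rewrite /e -expRM_natl; congr expR; field.
by rewrite pnatr_eq0 -lt0n.
Qed.

Let decay l j : V (l, j) -> e (l, j) <= decay_cst * decay_rate ^+ j.
Proof.
move=> /V_le/= jL; rewrite /e /decay_cst /decay_rate -expRM_natl -expRD ler_expR.
have n0' : 0 < n%:R :> R by rewrite ltr0n.
rewrite -(@ler_pM2r _ n%:R)// divfK ?gt_eqF//.
rewrite (_ : (_ + _) * _ = visual_eps * (2 * delta + 1) - visual_eps * (j%:R / 9)); last first.
  by field; rewrite gt_eqF.
rewrite -mulrN -mulrBr ler_wpM2l ?(ltW visual_eps_gt0)// /pP/=.
have := al_le jL; have := al0 l; have := @al_mono l 0 j; rewrite add0n => /(_ jL).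
lra.
Qed.

Let multiplicity q q' : V q -> same_cell V ann lev cell q q' -> q.1 = q'.1 ->
  (q'.2 <= q.2 + mult_cst)%N.
Proof.
move=> Vq qq' l1; have kqq := same_near Vq qq'.
have [qlt|] := leqP q.2 q'.2; last by move=> /ltnW/leq_trans -> //; rewrite leq_addr.
have Vq' : V q' by case/and4P: qq'.
have L1 := V_le Vq; have L2 := V_le Vq'.
have := @al_mono q.1 q.2 (q'.2 - q.2)%N; rewrite subnKC// {1}l1 => /(_ L2).
have := al_le L2; have := tri Gz (pG Vq') (pG Vq); have := pt_al L1.
rewrite /pP -l1 => h1 h2 h3 h4; have kqq' := kqq; rewrite /pP -l1 in kqq'.
rewrite -leq_subLR; apply: ltnW; rewrite -(ltr_nat R).
apply: le_lt_trans (truncnS_gt _); lra.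
Qed.

(** A chain step bounds the difference of the heights [f] by the visual distance; [wf] converts
    heights to indices at the price of one sampling jump. *)
Let height_le l l' r : G (w l) ->
  r - (4 * delta + 3) <= gromov_product k z (w l) (w l') ->
  r - (4 * delta + 3) <= k z (w l') - 1 - delta ->
  (l' : nat)%:R - (l : nat)%:R <= N%:R * shadow_cst * expR (- (visual_eps * r)).
Proof.
move=> Gl gp kl; have N0' : 0 < N%:R :> R by rewrite ltr0n.
have e0' : 0 <= visual_eps by exact/ltW/visual_eps_gt0.
have E1 : expR (- visual_eps * (r - (4 * delta + 3))) =
    expR (visual_eps * (4 * delta + 3)) * expR (- (visual_eps * r)).
  by rewrite -expRD; congr expR; ring.
have stp : f (w l') <= f (w l) + visual k z visual_eps (w l) (w l').
  by apply: (chain_dist_step (visual_ge0 _ _ _)).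
have v1 := visual_le e0' gp; rewrite E1 in v1.
have v2 : expR (- visual_eps * (k z (w l') - 1 - delta)) <=
    expR (visual_eps * (4 * delta + 3)) * expR (- (visual_eps * r)).
  by rewrite -E1 ler_expR !mulNr lerN2 ler_wpM2l.
have /andP[_ f2] := wf l'; have /andP[f1 _] := wf l.
set Y := expR _ * _ in v1 v2.
have : (l' : nat)%:R / (2 * N%:R) - (l : nat)%:R / (2 * N%:R) <= 2 * Y by lra.
rewrite -mulrBl ler_pdivrMr ?mulr_gt0// => /le_trans; apply.
by rewrite /shadow_cst /Y le_eqVlt; apply/orP; left; apply/eqP; ring.
Qed.

Let shadow q q' : V q -> same_cell V ann lev cell q q' ->
  `|(q'.1 : nat)%:R - (q.1 : nat)%:R| <= N%:R * shadow_cst * e q ^+ n.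
Proof.
move=> Vq qq'; have kqq := same_near Vq qq'; have d0 := delta0.
have Vq' : V q' by case/and4P: qq'.
have Gq := pG Vq; have Gq' := pG Vq'; have Gw := wG q.1; have Gw' := wG q'.1.
have q1 : k z (pP q) + k (pP q) (w q.1) <= k z (w q.1) + 1.
  by have := pt_al (V_le Vq); have := ptw (V_le Vq); rewrite /pP; lra.
have q2 : k z (pP q') + k (pP q') (w q'.1) <= k z (w q'.1) + 1.
  by have := pt_al (V_le Vq'); have := ptw (V_le Vq'); rewrite /pP; lra.
have := gromov_product_shadow kC qh_distxx hyp Gz delta0 Gq Gq' Gw Gw' q1 q2 kqq.
have := tri Gz Gq Gq'; have := kC Gq Gq'.
have := k0 (pP q) (w q.1); have := k0 (pP q') (w q'.1); rewrite eX.
move=> g1 g2 g3 g4 g5; rewrite ler_norml; apply/andP; split; last first.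
  by apply: height_le => //; lra.
(* The same estimate with the two samples exchanged, by symmetry of the Gromov product. *)
rewrite lerNl opprB; apply: height_le => //; last by lra.
by move: g5; rewrite /gromov_product (kC Gw Gw') (addrC (k (w q.1) z)); lra.
Qed.

(** Here the size of [N] enters: a point of an almost geodesic is at most 1 farther from [z] than
    its end sample. *)
Let shadow_ge1 q : V q -> 1 <= N%:R * shadow_cst * e q ^+ n.
Proof.
move=> Vq; rewrite eX; have d0 := delta0; have ep := visual_eps_gt0.
have : k z (pP q) <= k z (w q.1) + 1.
  have := pt_al (V_le Vq); have := ptw (V_le Vq); have := k0 (pP q) (w q.1).
  by rewrite /pP; lra.
move=> kq; rewrite -[leLHS]expR0 -(subrr (visual_eps * k z (pP q))) expRD ler_wpM2r ?expR_ge0//.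
apply: (@le_trans _ _ N%:R).
  by apply: le_trans (wN q.1); rewrite ler_expR ler_wpM2l// ltW.
rewrite ler_peMr// /shadow_cst.
have : 1 <= expR (visual_eps * (4 * delta + 3)); last by lra.
by rewrite -[leLHS]expR0 ler_expR mulr_ge0 ?(ltW ep)//; lra.
Qed.

Let rad_inj i i' v : rad i <= v < 4 * rad i -> rad i' <= v < 4 * rad i' -> i = i'.
Proof.
have mono j j' : (j < j')%N -> 4 * rad j <= rad j'.
  by move=> jj'; rewrite /rad mulrA -exprS ler_wpM2r ?mulr_ge0 ?(ltW D0)// ler_weXn2l// ler1n.
move=> /andP[h1 h2] /andP[h3 h4].
have [/mono H|/mono H|//] := ltngtP i i'.
  by have : v < v; [lra|rewrite ltxx].
by have : v < v; [lra|rewrite ltxx].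
Qed.

Let V_ann l (j : 'I_K) i : (j <= L l)%N ->
  rad (i : 'I_m) <= enorm (pt l j - x) < 4 * rad i -> V (l, j) && (ann (l, j) == i).
Proof.
move=> jL ri; have Vlj : V (l, j) by rewrite /V/= jL; apply/existsP; exists i.
by rewrite Vlj; apply/eqP/val_inj; exact: rad_inj (annP Vlj) ri.
Qed.

Let d_le u : d u <= 4 * D + enorm (u - x).
Proof.
by have := bdist_lip Gdom GT u Gx; rewrite (enorm_distC x); have := dx; lra.
Qed.

(** Each chain starts at [z], beyond all annuli, and ends near its sample, inside all of them. As
    [d x <= 4 * D], in an annulus and farther out [d] is at most twice the distance to [x], so
    [crossing_sum] applies; the level turns [d / 8] into at most [rad * (1 / 2) ^+ lev]. *)
Let crossing l i : 1 <= \sum_(j < K | V (l, j) && (ann (l, j) == i))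
  (1 / 2) ^+ lev (l, j) :> R.
Proof.
have r0 := rad_gt0 i; have D0' := D0.
have rD : 4 * D <= rad i.
  by rewrite /rad ler_peMl ?mulr_ge0 ?(ltW D0)// exprn_ege1// ler1n.
have dp0 j : (j <= L l)%N -> 0 <= d (pt l j).
  by move=> /(ptG (l := l)) Gp; exact/ltW/(bdist_gt0 Gdom GT).
have : rad i <= \sum_(j < (L l).+1 | (rad i <= enorm (pt l j - x)) &&
    (enorm (pt l j - x) < 4 * rad i)) d (pt l j) / 8.
  apply: (@crossing_sum R (L l) (fun j => enorm (pt l j - x)) (fun j => d (pt l j))) => //.
  - rewrite pt0; apply: le_trans zx; rewrite exprS -mulrA -/(rad m).
    suff : rad i <= rad m by lra.
    by rewrite /rad ler_wpM2r ?mulr_ge0 ?(ltW D0)// ler_weXn2l ?ler1n// ltnW.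
  - have GL := ptG (leqnn (L l)); have := ptL l.
    have := bdist_lip Gdom GT (pt l (L l)) (wG l); have := d_le (w l).
    have := ler_enorm_dist (w l) (pt l (L l)) x; rewrite (enorm_distC _ (w l)).
    have := wD l; lra.
  - move=> j jL; apply: le_trans (ptS jL); rewrite ler_norml.
    have := ler_enorm_dist (pt l j) (pt l j.+1) x.
    have := ler_enorm_dist (pt l j.+1) (pt l j) x.
    by rewrite (enorm_distC (pt l j) (pt l j.+1)) => h1 h2; apply/andP; split; lra.
  - by move=> j jL ru; have := d_le (pt l j); lra.
rewrite -[X in X <= _ -> _]mulr1 => H; rewrite -(@ler_pM2l _ (rad i))//.
apply: (le_trans H); rewrite {H}.
have LK : ((L l).+1 <= K)%N by rewrite ltnS; exact: leq_bigmax.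
rewrite (big_ord_widen_cond K (fun j => (rad i <= enorm (pt l j - x)) &&
  (enorm (pt l j - x) < 4 * rad i)) (fun j => d (pt l j) / 8))//.
rewrite mulr_sumr [leLHS]big_mkcond [leRHS]big_mkcond/=; apply: ler_sum => j _.
have [/andP[ri jL]|_] := boolP (_ && _); last first.
  by case: ifP => // _; rewrite mulr_ge0 ?exprn_ge0 ?(ltW r0).
have Vj := V_ann jL ri; rewrite Vj; case/andP: Vj => Vj /eqP aE.
have /andP[lv _] := levP Vj; move: lv; rewrite aE /pP/=.
have dp : 0 < d (pt l j) by exact: (bdist_gt0 Gdom GT (ptG jL)).
rewrite ler_pdivlMr// div1r exprVn => lv.
by rewrite ler_pdivlMr ?exprn_gt0//; lra.
Qed.

Lemma annuli_le : m%:R <= annuli_cst.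
Proof.
apply: (@cell_counting R n N K m V ann lev cell (8 * n) mult_cst e shadow_cst
  decay_cst decay_rate) => //.
- by rewrite muln_gt0.
- by rewrite mulr_ge0// expR_ge0.
- exact: expR_ge0.
- exact: expR_ge0.
- exact: decay_rate_lt1.
- by move=> p; exact: expR_ge0.
Qed.

End counting.

Lemma annuli_bound : m%:R <= annuli_cst.
Proof.
(* No annulus is a separate case: outside [V] the labelling needs a default element of ['I_m]. *)
have [m0|m0] := posnP m.
  rewrite m0 /annuli_cst mulr_ge0// mulr_ge0 ?invr_ge0 ?subr_ge0 ?(ltW decay_rate_lt1)//.
  by rewrite mulr_ge0 ?expR_ge0// addr_ge0// !mulr_ge0 ?exprn_ge0// expR_ge0.
have [N N0 [w [wG wD wf wN]]] := curve_samples.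
have ch l : exists c : nat * (nat -> 'rV[R]_n) * (nat -> R), [/\ c.1.2 0%N = z,
    forall j, (j <= c.1.1)%N ->
      [/\ G (c.1.2 j), j%:R / 9 <= c.2 j, k z (c.1.2 j) <= c.2 j
        & k (c.1.2 j) (w l) <= k z (w l) + 1 - c.2 j],
    forall j, (j < c.1.1)%N ->
      enorm (c.1.2 j.+1 - c.1.2 j) <= d (c.1.2 j) / 8 /\ c.2 j + 1 / 9 <= c.2 j.+1
    & enorm (w l - c.1.2 c.1.1) <= d (c.1.2 c.1.1) / 8].
  have [L [p [al H]]] := qh_chain Gdom GT Gz (wG l).
  by exists (L, p, al).
have [c cP] := choice ch.
pose L l := (c l).1.1; pose pt l := (c l).1.2; pose al l := (c l).2.
pose K := (\max_l L l).+1; pose rad (i : nat) : R := 4 ^+ i * (4 * D).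
pose V (q : 'I_N * 'I_K) := (q.2 <= L q.1)%N &&
  [exists i : 'I_m, rad i <= enorm (pt q.1 q.2 - x) < 4 * rad i].
have lab q : exists c : 'I_m * nat, V q ->
    rad c.1 <= enorm (pt q.1 q.2 - x) < 4 * rad c.1 /\
    2 ^+ c.2 <= 8 * rad c.1 / d (pt q.1 q.2) < 2 ^+ c.2.+1.
  have [Vq|nV] := boolP (V q); last by exists (Ordinal m0, 0%N).
  case/andP: (Vq) => qL /existsP[i ri].
  have [_ /(_ _ qL)[Gq _ _ _] _ _] := cP q.1.
  have dq := bdist_gt0 Gdom GT Gq.
  have rD : 4 * D <= rad i.
    by rewrite /rad ler_peMl ?mulr_ge0 ?(ltW D0)// exprn_ege1// ler1n.
  have [||s sP] := @powers_bracket R 2 (8 * rad i / d (pt q.1 q.2)).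
  - by rewrite ltr1n.
  - rewrite ler_pdivlMr// mul1r.
    have := bdist_lip Gdom GT (pt q.1 q.2) Gx; rewrite (enorm_distC x).
    by have := dx; have := D0; case/andP: ri; lra.
  - by exists (i, s).
have [lb lbP] := choice lab.
apply: (@annuli_le N w L pt al (fun q => (lb q).1) (fun q => (lb q).2)) => //.
- by move=> l; have [] := cP l.
- by move=> l j jL; have [_ /(_ _ jL)[]] := cP l.
- by move=> l j jL; have [_ /(_ _ jL)[]] := cP l.
- by move=> l j jL; have [_ /(_ _ jL)[]] := cP l.
- by move=> l j jL; have [_ _ /(_ _ jL)[]] := cP l.
- by move=> l; have [_ /(_ _ (leq0n _))[_ + _ _]] := cP l; rewrite mul0r.
- by move=> l j jL; have [_ _ /(_ _ jL)[]] := cP l.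
- by move=> l; have [] := cP l.
- by move=> q /lbP[].
- by move=> q /lbP[].
Qed.

End annuli.
(** Beyond this radius there is room for [(Num.truncn annuli_cst).+1] annuli, one more than
    [annuli_bound] permits. *)
Definition radius_cst : R := 4 ^+ (Num.truncn annuli_cst).+2 * 4.

Lemma radius_cst_ge4 : 4 <= radius_cst.
Proof. by rewrite ler_peMl// exprn_ege1// ler1n. Qed.

Lemma geodesic_radius (x y z : 'rV[R]_n) (a b : R) (g : R -> 'rV[R]_n) (D : R) :
  G z -> curve_in G x y a b g -> x <> y -> 0 < D ->
  (forall t, t \in `[a, b] -> enorm (g t - x) <= D) ->
  gromov_product k z x y <= 0 -> k x z <= k x y ->
  enorm (z - x) <= radius_cst * D.
Proof.
move=> Gz gxy xy D0 gD xyz kz; have [ab _ gG gx gy] := gxy.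
have Gx : G x by rewrite -gx; apply: gG; exists a; rewrite //= in_itv/= lexx.
have dx0 := bdist_gt0 Gdom GT Gx.
rewrite leNgt; apply/negP => far.
have [dx|dx] := leP (d x) (4 * D).
  have [] : ~ (Num.truncn annuli_cst).+1%:R <= annuli_cst.
    by apply/negP; rewrite -ltNge truncnS_gt.
  apply: (annuli_bound Gz gxy xy xyz gD D0 dx).
  by rewrite mulrA ltW.
have xyD : enorm (x - y) <= D.
  by rewrite enorm_distC -gy gD// in_itv/= lexx ab.
have k1 : k x y <= 2 * D / d x.
  apply: (le_trans (qh_dist_near_le Gdom GT Gx _)); first lra.
  by rewrite ler_wpM2r ?invr_ge0 ?(ltW dx0)// ler_wpM2l.
have : 4 * D / (d x + 4 * D) <= k x z.
  apply: qh_dist_ge => //; first by rewrite mulr_gt0.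
  by have := ler_wpM2r (ltW D0) radius_cst_ge4; lra.
(* Equivalent to [4 * D < d x]: being far from [x] would make [k x z] exceed [k x y]. *)
have : 2 * D / d x < 4 * D / (d x + 4 * D); last by lra.
rewrite ltr_pdivrMr// mulrAC ltr_pdivlMr; last by lra.
have := mulr_gt0 D0 D0; nra.
Qed.

Lemma geodesic_diam (x y : 'rV[R]_n) (l : R) (sigma : R -> 'rV[R]_n)
    (a b : R) (g : R -> 'rV[R]_n) :
  G x -> G y -> qh_geodesic G x y l sigma -> curve_in G x y a b g ->
  (ediam (sigma @` `[0%R, l]) <= (2 * radius_cst)%:E * ediam (g @` `[a, b]))%E.
Proof.
move=> Gx Gy [l0 sG s0 sl ks] gxy; have [ab _ _ gx gy] := gxy.
have C4 := radius_cst_ge4.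
have aab : a \in `[a, b] by rewrite in_itv/= lexx.
have bab : b \in `[a, b] by rewrite in_itv/= lexx ab.
have in0 : 0 \in `[0, l] by rewrite in_itv/= lexx.
have inl : l \in `[0, l] by rewrite in_itv/= lexx l0.
have gE t t' : t \in `[a, b] -> t' \in `[a, b] ->
    ((enorm (g t - g t'))%:E <= ediam (g @` `[a, b]))%E.
  move=> tab t'ab; apply: ereal_sup_ubound.
  by exists (g t); [exists t|exists (g t') => //; exists t'].
case: (ediam (g @` `[a, b])) gE => [D| |] gE; last first.
- by have := gE a a aab aab.
- by rewrite gt0_muley ?leey// lte_fin; lra.
have gD t : t \in `[a, b] -> enorm (g t - x) <= D.
  by move=> tab; rewrite -lee_fin -gx gE.
apply: ge_ereal_sup => _ [_ [s sl' <-] [_ [t tl <-] <-]].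
rewrite -EFinM lee_fin.
have kl : k x y = l by rewrite -s0 -sl ks// sub0r normrN ger0_norm.
have [xy|xy] := eqVneq x y.
  (* Coinciding end points reduce the geodesic to a single point. *)
  have l00 : l = 0 by rewrite -kl -xy qh_distxx.
  have z0 r : r \in `[0, l] -> r = 0.
    by rewrite in_itv/= l00 => /le_anti.
  rewrite (z0 _ sl') (z0 _ tl) subrr enorm0 mulr_ge0//; first by lra.
  exact: le_trans (enorm_ge0 _) (gD a aab).
have {}xy : x <> y by apply/eqP.
have D0 : 0 < D.
  have := gD b bab; rewrite gy enorm_distC; apply: lt_le_trans.
  by rewrite lt_def enorm_ge0 andbT; apply/eqP => /enorm_dist_eq0.
have rad r : r \in `[0, l] -> enorm (sigma r - x) <= radius_cst * D.
  move=> rl; have := rl; rewrite in_itv/= => /andP[r0 rl'].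
  have kxr : k x (sigma r) = r by rewrite -s0 ks// sub0r normrN ger0_norm.
  have kyr : k y (sigma r) = l - r by rewrite -sl ks// ger0_norm// subr_ge0.
  apply: (@geodesic_radius x y (sigma r) a b g) => //.
  - by apply: sG; exists r.
  - by rewrite /gromov_product kl kxr kyr; lra.
  - by rewrite kl kxr.
(* Two points of the geodesic are compared through [x], whence the factor 2. *)
have := ler_enorm_dist x (sigma s) (sigma t); rewrite (enorm_distC x).
by have := rad _ sl'; have := rad _ tl; lra.
Qed.

End main_estimate.

Theorem theorem1p2 (R : realType) (n : nat) (hn : (2 <= n)%N)
    (delta : R) (hdelta : 0 <= delta) :
  exists Cpo : R, forall G : set 'rV[R]_n,
    is_domain G -> G <> setT -> gromov_hyperbolic G delta ->
    forall (x y : 'rV[R]_n) (l : R) (sigma : R -> 'rV[R]_n),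
      G x -> G y -> qh_geodesic G x y l sigma ->
      (forall (a b : R) (g : R -> 'rV[R]_n), curve_in G x y a b g ->
         (ediam (sigma @` `[0%R, l]) <= Cpo%:E * ediam (g @` `[a, b]))%E) /\
      (forall Cbt : R, 1 <= Cbt -> bounded_turning G Cbt ->
         (ediam (sigma @` `[0%R, l]) <= (Cbt * Cpo * enorm (x - y))%:E)%E).
Proof.
have n0 : (0 < n)%N := ltnW hn.
exists (2 * radius_cst (n := n) delta) => G Gdom GT hyp x y l sigma Gx Gy geo.
have diam := geodesic_diam n0 hdelta Gdom GT hyp Gx Gy geo.
split=> [//|Cbt _ bt]; have [a [b [g [gxy gd]]]] := bt x y Gx Gy.
apply: le_trans (diam a b g gxy) _.
rewrite (_ : Cbt * _ * _ = 2 * radius_cst (n := n) delta * (Cbt * enorm (x - y))); last by ring.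
rewrite [leRHS]EFinM lee_wpmul2l// lee_fin mulr_ge0//.
by have := @radius_cst_ge4 R n delta; lra.
Qed.
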